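(* Let $d=2$, $k=1$, $0\le t_0<T$, and consider $\dot x(t)=N_t(x(t))+B_tu(t)$, $x(t_0)=x^0$, on $[t_0,T]$ with $N_t$ and $B_t$ satisfying the standing assumptions of the context. Assume that for some $\beta>0$ $$\inf_{t\in[t_0,T]}\ \inf_{x\in\mathbb R^2}\ \big|\det\big(B_t,\ DN_t(x)B_t-\dot B_t\big)\big|\ \ge\ \beta .$$ Fix $x^0\in\mathbb R^2$ and $U>0$. Then there is a constant $\alpha_{\mathcal M_T}=\alpha_{\mathcal M_T}(\beta,|x^0|,U)>0$ such that $$\mathcal M_T(u)\succeq\alpha_{\mathcal M_T}\,\mathrm{Id}\qquad\text{for all }u\in L^\infty(t_0,T)\text{ with }\|u\|_\infty\le U.$$
   Context: Standing assumptions. $N_t:\mathbb R^2\to\mathbb R^2$, $t\in[t_0,T]$: $t\mapsto N_t(x)$ is $L^\infty$ for every $x$; $x\mapsto N_t(x)$ is $C^2$ for every $t$; there are constants $\Lambda_1,\Lambda_2\ge0$ with $\|DN_t(x)\|\le\Lambda_1$ and $\|D^2N_t(x)\|\le\Lambda_2$ for all $(t,x)\in[t_0,T]\times\mathbb R^2$ (derivatives with respect to $x$); in addition $\partial_tDN_t(x)$ is essentially bounded in $t\in(t_0,T)$, uniformly in $x\in\mathbb R^2$. The input vector $B_t\in\mathbb R^2$ is independent of the state and $B_t,\dot B_t,\ddot B_t\in L^\infty((t_0,T);\mathbb R^2)$ (dots denote time derivatives). Notation. $\det(a,b)$ is the determinant of the $2\times2$ matrix with columns $a,b$. The control $u$ is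 scalar-valued. For $u\in L^\infty(t_0,T)$, $x_u$ is the unique absolutely continuous solution of $\dot x_u(t)=N_t(x_u(t))+B_tu(t)$, $x_u(t_0)=x^0$; $R_u(t,s)$ is the state-transition matrix, $R_u(s,s)=\mathrm{Id}$, of $\dot y(t)=DN_t(x_u(t))y(t)$; and $$\mathcal M_T(u):=\int_{t_0}^TR_u(T,t)B_tB_t^\top R_u(T,t)^\top\,dt\in\mathbb R^{2\times2}.$$ For symmetric matrices, $P\succeq Q$ means $P-Q$ is positive semidefinite. The system $N,B$ and the horizon $[t_0,T]$ are fixed; the displayed dependence of $\alpha_{\mathcal M_T}$ is in addition to its dependence on these fixed data, and $\alpha_{\mathcal M_T}$ does not depend on $u$. *)

(* Defs.v *)
From HB Require Import structures.
From mathcomp Require Import all_boot all_order all_algebra.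
From mathcomp Require Import all_classical all_reals all_analysis.

Set Implicit Arguments.
Unset Strict Implicit.
Unset Printing Implicit Defensive.

Import Order.TTheory GRing.Theory Num.Theory.
Import numFieldNormedType.Exports.

Local Open Scope classical_set_scope.
Local Open Scope ring_scope.

(* Euclidean norm; the library norm `|v| on matrices is the sup norm. *)
Definition enorm (R : realType) (n : nat) (v : 'cV[R]_n) : R :=
  Num.sqrt (\sum_(i < n) v i 0 ^+ 2).

(* det2 a b is the determinant of the matrix with columns a and b. *)
Definition det2 (R : realType) (a b : 'cV[R]_2) : R :=
  \det (row_mx a b : 'M[R]_2).

(* Loewner order: loewner_ge P Q says that P - Q is positive semidefinite. *)
Definition psd (R : realType) (n : nat) (P : 'M[R]_n) : Prop :=
  P^T = P /\ forall v : 'cV[R]_n, 0 <= (v^T *m P *m v) 0 0.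

Definition loewner_ge (R : realType) (n : nat) (P Q : 'M[R]_n) : Prop :=
  psd (P - Q).

(* Jacobian matrix in the column convention: jac f x *m v is the derivative of
   f at x applied to v (the library jacobian acts on row vectors). *)
Definition jac (R : realType) (n : nat) (f : 'cV[R]_n.+1 -> 'cV[R]_n.+1)
    (x : 'cV[R]_n.+1) : 'M[R]_n.+1 :=
  \matrix_(i, j) ('D_(delta_mx j 0) f x) i 0.

Definition C1 (R : realType) (V W : normedModType R) (f : V -> W) : Prop :=
  (forall x, differentiable f x) /\ (forall v, continuous (fun x => 'D_v f x)).

(* On a finite-dimensional V this is the usual C^2: every directional
   derivative of the C^1 map f is again C^1. *)
Definition C2 (R : realType) (V W : normedModType R) (f : V -> W) : Prop :=
  C1 f /\ (forall v, C1 (fun x => 'D_v f x)).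

(* The L^oo(]a, b[) norm of f, obtained by extending f by 0 outside ]a, b[. *)
Definition Linf_norm (R : realType) (a b : R) (f : R -> R) : \bar R :=
  ('N[@lebesgue_measure R]_+oo [EFin \o (f \_ `]a, b[)])%E.

(* Membership in L^oo(]a, b[).  Measurability is Borel in the library;
   Lebesgue measurability means being a.e. equal to a Borel function. *)
Definition Linf (R : realType) (a b : R) (f : R -> R) : Prop :=
  (exists2 g : R -> R, measurable_fun `]a, b[ g &
     {ae (@lebesgue_measure R), forall t, t \in `]a, b[ -> f t = g t}) /\
  (Linf_norm a b f < +oo)%E.

Definition Linf_mx (R : realType) (m n : nat) (a b : R)
    (f : R -> 'M[R]_(m, n)) : Prop :=
  forall i j, Linf a b (fun t => f t i j).

Definition abs_continuous (R : realType) (V : normedModType R) (a b : R)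
    (f : R -> V) : Prop :=
  forall eps : R, 0 < eps -> exists2 delta : R, 0 < delta &
    forall (n : nat) (l r : 'I_n -> R),
      (forall i, a <= l i /\ l i <= r i /\ r i <= b) ->
      trivIset setT (fun i => `]l i, r i[%classic) ->
      \sum_(i < n) (r i - l i) < delta ->
      \sum_(i < n) `|f (r i) - f (l i)| < eps.

(* f is absolutely continuous on [a, b] with derivative g almost everywhere. *)
Definition ac_derivative (R : realType) (V : normedModType R) (a b : R)
    (f g : R -> V) : Prop :=
  abs_continuous a b f /\
  {ae (@lebesgue_measure R), forall t : R, t \in `]a, b[ ->
     is_derive t 1 f (g t)}.

(* Regularity of the vector field N on [t0, T].  The condition that the time
   derivative of DN_t(x) is in L^oo is the one of W^{1,oo}: t |-> DN_t(x) is
   absolutely continuous, and its a.e. derivative has an essential bound that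
   does not depend on x. *)
Definition field_assumptions (R : realType) (t0 T : R)
    (N : R -> 'cV[R]_2 -> 'cV[R]_2) : Prop :=
  [/\ forall x, Linf_mx t0 T (fun t => N t x),
      forall t, t \in `[t0, T] -> C2 (N t),
      exists2 L1 : R, 0 <= L1 & forall t x v, t \in `[t0, T] ->
        enorm (jac (N t) x *m v) <= L1 * enorm v,
      exists2 L2 : R, 0 <= L2 & forall t x v w, t \in `[t0, T] ->
        enorm ('D_w (fun y => 'D_v (N t) y) x) <= L2 * enorm v * enorm w &
      exists L3 : R, forall x, exists2 dtDN : R -> 'M[R]_2,
        ac_derivative t0 T (fun t => jac (N t) x) dtDN &
        Linf_mx t0 T dtDN /\
        forall i j, (Linf_norm t0 T (fun t => dtDN t i j) <= L3%:E)%E].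

(* B is in W^{2,oo}, dB is its derivative.  Absolute continuity of dB selects
   the continuous representative, so dB is determined on all of [t0, T]. *)
Definition input_assumptions (R : realType) (t0 T : R)
    (B dB : R -> 'cV[R]_2) : Prop :=
  [/\ ac_derivative t0 T B dB, Linf_mx t0 T B, Linf_mx t0 T dB &
      exists2 ddB : R -> 'cV[R]_2, ac_derivative t0 T dB ddB &
        Linf_mx t0 T ddB].

Definition is_trajectory (R : realType) (t0 T : R)
    (N : R -> 'cV[R]_2 -> 'cV[R]_2) (B : R -> 'cV[R]_2) (x0 : 'cV[R]_2)
    (u : R -> R) (x : R -> 'cV[R]_2) : Prop :=
  x t0 = x0 /\ ac_derivative t0 T x (fun t => N t (x t) + u t *: B t).

(* Phi t s is the state-transition matrix of y' = DN_t(x(t)) y. *)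
Definition is_transition_matrix (R : realType) (t0 T : R)
    (N : R -> 'cV[R]_2 -> 'cV[R]_2) (x : R -> 'cV[R]_2)
    (Phi : R -> R -> 'M[R]_2) : Prop :=
  forall s, s \in `[t0, T] ->
    Phi s s = 1%:M /\
    ac_derivative t0 T (fun t => Phi t s)
      (fun t => jac (N t) (x t) *m Phi t s).

Definition gramian (R : realType) (t0 T : R) (B : R -> 'cV[R]_2)
    (Phi : R -> R -> 'M[R]_2) : 'M[R]_2 :=
  \matrix_(i, j) \int[@lebesgue_measure R]_(t in `[t0, T])
    (Phi T t *m B t *m (B t)^T *m (Phi T t)^T) i j.

(* Main.v *)
Require Import Defs.
From HB Require Import structures.
From mathcomp Require Import all_boot all_order all_algebra.
From mathcomp Require Import all_classical all_reals all_analysis.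
From mathcomp Require Import measurable_realfun ess_sup_inf ring lra.
Set Implicit Arguments.
Unset Strict Implicit.
Unset Printing Implicit Defensive.
Import Order.TTheory GRing.Theory Num.Theory.
Import numFieldNormedType.Exports.
Local Open Scope classical_set_scope.
Local Open Scope ring_scope.

(** Why the Gramian is uniformly positive. For a vector [v] the number [v^T M_T(u) v] is
    the integral of the square of the signal [phi t = v^T R(T,t) B_t]. Along a
    trajectory put [A t = DN_t(x_u(t))]; the row [v^T R(T,t)] solves the adjoint
    equation, so [phi' = - psi] with [psi t = v^T R(T,t) (A t B_t - dB_t)]. The
    determinant hypothesis says that [B_t] and [A t B_t - dB_t] are quantitatively
    independent, so [phi] and [psi] cannot both be small compared with [v].

    It is enough to exploit this near [t0]. The function [psi] is Lipschitz with a
    constant that depends only on the fixed data, on [|x0|] and on [U], so on a short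
    interval [[t0, t0 + h]] the signal [phi] is affine up to an error of order [h^2].
    An affine function whose value and slope are not both small has a square with
    integral of order [h^3] at least, while the error contributes [h^5]
    ([affine_observability], [kalman_observability]).

    The Lipschitz bound on [psi] needs one on [A]: bounded controls give bounded
    trajectories by Gronwall, these are Lipschitz in time, and [DN_t(x)] is Lipschitz
    in [t] and in [x] separately ([jac_trajectory_lipschitz]).

    All functions of time are absolutely continuous with derivatives known almost
    everywhere. Every estimate on them rests on one fact, that a nonpositive almost
    everywhere derivative forces monotonicity ([ac_nonincreasing]), from which
    Gronwall's inequality and Lipschitz bounds follow. The adjoint equation comes
    from the transition matrix by [adjoint_state]. *)

(** * Monotonicity from the sign of an almost everywhere derivative *)

(** A derivative at [c] controls the slopes of all chords over intervals that
    contain [c], whether or not [c] is an endpoint; this is what a supremum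
    argument needs, where [c] is approached from the left and then passed. *)
Lemma derivative_straddle (R : realType) (f : R -> R) (c d e : R) :
  is_derive c 1 f d -> d <= 0 -> 0 < e ->
  exists2 eta, 0 < eta & forall x y, c - eta < x -> x <= c -> c <= y ->
    y < c + eta -> f y - f x <= e * (y - x).
Proof.
move=> [df dE] d0 e0.
have : (fun h => h^-1 *: ((f \o shift c) (h *: (1:R)) - f c)) @ 0^' --> d.
  by rewrite -dE; exact: df.
move/cvgrPdist_lt => /(_ e e0).
move/nbhs_ballP => [eta eta0 H].
exists eta => // x y x1 xc cy y1.
have K z : `|z - c| < eta -> `|f z - f c - d * (z - c)| <= e * `|z - c|.
  move=> zc.
  have [->|zne] := eqVneq z c; first by rewrite !subrr normr0 !mulr0 subr0 normr0.
  have zc0 : z - c != 0 by rewrite subr_eq0.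
  have := H (z - c); rewrite /ball/= sub0r normrN => /(_ zc zc0).
  rewrite /= /shift /= {2}/GRing.scale/= mulr1 subrK.
  set q := f z - f c.
  have -> : d - (z - c)^-1 *: q = (z - c)^-1 * (d * (z - c) - q).
    by rewrite /GRing.scale /=; field.
  rewrite normrM normfV mulrC ltr_pdivrMr ?normr_gt0// => /ltW.
  by rewrite distrC.
have := K y; have := K x.
rewrite [`|y - c|]ger0_norm ?subr_ge0// [`|x - c|]ler0_norm ?subr_le0//.
move=> /(_ ltac:(lra)); rewrite ler_norml => /andP[Kx _].
move=> /(_ ltac:(lra)); rewrite ler_norml => /andP[_ Ky].
have dy : d * (y - c) <= 0 by rewrite mulr_le0_ge0// subr_ge0.
have dx : 0 <= d * (x - c) by rewrite mulr_le0// subr_le0.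
lra.
Qed.

(** Outer regularity of the Lebesgue measure. *)
Lemma negligible_open_cover (R : realType) (E : set R) (eps : R) :
  (@lebesgue_measure R).-negligible E -> 0 < eps ->
  exists O : set R, [/\ open O, E `<=` O & (lebesgue_measure O < eps%:E)%E].
Proof.
move=> [A [mA A0 EA]] eps0.
have [|O [oO AO OAe]] := @lebesgue_regularity_outer R A eps mA _ eps0.
  by rewrite [X in (X < _)%E](_ : _ = 0%E) ?ltry//; exact: A0.
exists O; split => //; first exact: subset_trans AO.
have mO : measurable O by exact: open_measurable.
rewrite -(setDUK AO) measureU//; [|exact: measurableD|].
  by rewrite [X in (X + _)%E](_ : _ = 0%E) ?add0e//; exact: A0.
by rewrite setDE setIC -setIA setICl setI0.
Qed.

Lemma sum_itv_length_le (R : realType) (O : set R) (n : nat) (l r : 'I_n -> R) :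
  measurable O -> (forall i, l i <= r i) ->
  (forall i, `]l i, r i[ `<=` O) ->
  trivIset setT (fun i => `]l i, r i[%classic) ->
  ((\sum_(i < n) (r i - l i))%:E <= lebesgue_measure O)%E.
Proof.
move=> mO lr lrO tlr.
have -> : (\sum_(i < n) (r i - l i))%:E =
    lebesgue_measure (\big[setU/set0]_(i < n) `]l i, r i[%classic).
  rewrite (@measure_bigsetU_ord _ _ _ lebesgue_measure)//= -sumEFin.
  apply: eq_bigr => i _; rewrite lebesgue_measure_itv/= lte_fin.
  by case: ltP => // ri; rewrite (@le_anti _ _ (l i) (r i)) ?lr ?ri// subrr.
apply: le_measure; rewrite ?inE//.
- exact: bigsetU_measurable.
- apply: (big_ind (fun A => A `<=` O)) => [|A A'|i _]; first exact: sub0set.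
    by rewrite subUset.
  exact: lrO.
Qed.

(** Intervals lying to the left of [x] stay disjoint when [`]x, y[] is added, as
    the new first element of the family. *)
Lemma trivIset_extend (R : realType) (n : nat) (l r : 'I_n -> R) (x y : R) :
  (forall i, r i <= x) ->
  trivIset setT (fun i => `]l i, r i[%classic) ->
  trivIset setT (fun i : 'I_n.+1 =>
    `]oapp l x (unlift ord0 i), oapp r y (unlift ord0 i)[%classic).
Proof.
move=> rx /trivIsetP tlr; apply/trivIsetP => i j _ _.
case: (unliftP ord0 i) => [i'|] ->; case: (unliftP ord0 j) => [j'|] -> /=;
  rewrite ?liftK ?unlift_none /=.
- by move=> ij; apply: tlr => //; apply: contra_neq ij => ->.
- move=> _; rewrite -subset0 => z [] /=; rewrite !in_itv/= => /andP[_ z1] /andP[z2 _].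
  by have := rx i'; lra.
- move=> _; rewrite -subset0 => z [] /=; rewrite !in_itv/= => /andP[z2 _] /andP[_ z1].
  by have := rx j'; lra.
- by move=> /eqP.
Qed.

(** Absolutely continuous functions obey the sign of their almost everywhere
    derivative. The bad points form a null set, hence lie in an open set [G] so
    small that [f] varies by at most [e] over disjoint intervals inside [G]. Moving
    from [s] to [t], each good point is passed with slope at most [e], and
    each bad point inside an interval of [G] that is put on a list; the
    supremum of the points reached this way is [t]. *)
Lemma ac_nonincreasing (R : realType) (a b : R) (f g : R -> R) :
  ac_derivative a b f g ->
  {ae (@lebesgue_measure R), forall t, t \in `]a, b[ -> g t <= 0} ->
  forall s t, a <= s -> s <= t -> t <= b -> f t <= f s.
Proof.
move=> [acf dfg] g0 s t as_ st tb.
apply/ler_addgt0Pr => e0 e00.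
pose e := e0 / (t - s + 1).
have e_gt0 : 0 < e by rewrite divr_gt0//; lra.
have [delta delta0 Hdelta] := acf e e_gt0.
(* The endpoints count as bad points: no derivative is known there. *)
pose E := ~` [set x | x \in `]a, b[ -> is_derive x 1 f (g x)] `|`
  ~` [set x | x \in `]a, b[ -> g x <= 0] `|` [set a] `|` [set b].
have negE : (@lebesgue_measure R).-negligible E.
  apply: negligibleU; [apply: negligibleU; [exact: negligibleU|]|];
    by apply/negligibleP => //; exact: lebesgue_measure_set1.
have [G [oG EG mG]] := negligible_open_cover negE delta0.
(* [P c]: from [s] to [c], [f] grows by at most [e * (c - s)] plus its increments
   over the list of intervals crossed so far. *)
pose P c := s <= c /\ exists n (l r : 'I_n -> R),
  [/\ forall i, s <= l i /\ l i <= r i /\ r i <= c,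
      forall i, `]l i, r i[ `<=` G,
      trivIset setT (fun i => `]l i, r i[%classic) &
      f c - f s <= e * (c - s) + \sum_(i < n) (f (r i) - f (l i))].
have Ps : P s.
  split=> //; exists 0%N, (fun=> 0), (fun=> 0); split; try by case.
  by rewrite big_ord0 !subrr mulr0 addr0.
have step c : s <= c -> c <= t -> exists2 eta : R, 0 < eta & forall x y : R,
    c - eta < x -> x <= c -> c <= y -> y < c + eta -> P x -> P y.
  move=> sc ct.
  have [Ec|nEc] := pselect (E c).
    have /nbhs_ballP[eta eta0 etaG] : nbhs c G by apply: oG; exact: EG.
    exists eta => // x y x1 xc cy y1 [sx [n [l [r [lr lrG tlr fx]]]]].
    split; first lra.
    exists n.+1, (fun i => oapp l x (unlift ord0 i)),
      (fun i => oapp r y (unlift ord0 i)); split.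
    - move=> i; case: (unliftP ord0 i) => [i'|] _ /=.
        by have := lr i'; lra.
      by lra.
    - move=> i; case: (unliftP ord0 i) => [i'|] _ /=.
        exact: lrG.
      move=> z /=; rewrite in_itv/= => /andP[xz zy]; apply: etaG.
      by rewrite /ball/= ltr_norml; lra.
    - by apply: trivIset_extend => // i; have := lr i; lra.
    - rewrite big_ord_recl unlift_none /=.
      under eq_bigr do rewrite liftK /=.
      have : e * (x - s) <= e * (y - s) by rewrite ler_pM2l//; lra.
      by lra.
  have [H1 H2 [ca cb]] : [/\ c \in `]a, b[ -> is_derive c 1 f (g c),
      c \in `]a, b[ -> g c <= 0 & c <> a /\ c <> b].
    split.
    - by apply: contrapT => h; apply: nEc; left; left; left.
    - by apply: contrapT => h; apply: nEc; left; left; right.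
    - by split=> h; apply: nEc; [left; right|right].
  have cab : c \in `]a, b[.
    rewrite in_itv/= !lt_neqAle (le_trans as_ sc) (le_trans ct tb) !andbT.
    by apply/andP; split; apply/eqP => h; [apply: ca|apply: cb].
  have [eta eta0 Heta] := derivative_straddle (H1 cab) (H2 cab) e_gt0.
  exists eta => // x y x1 xc cy y1 [sx [n [l [r [lr lrG tlr fx]]]]].
  split; first lra.
  exists n, l, r; split => //.
    by move=> i; have := lr i; lra.
  by have := Heta x y x1 xc cy y1; lra.
pose S := [set c | c <= t /\ P c].
have hS : has_sup S by split; [exists s|exists t => x []].
have Sub : ubound S (sup S) by exact: sup_upper_bound.
have sS : s <= sup S by apply: Sub; split.
have St : sup S <= t by apply: sup_le_ub; [exists s|move=> x []].
have [eta eta0 Heta] := step _ sS St.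
have [x [xt Px] xS] := sup_adherent eta0 hS.
have xS' : x <= sup S by apply: Sub; split.
have [supt|supt] := ltP (sup S) t.
  pose y := Num.min t (sup S + eta / 2).
  have [yt ys ye] : [/\ y <= t, sup S < y & y < sup S + eta].
    by rewrite /y; case: (leP t (sup S + eta / 2)) => ?; split; lra.
  have Py : P y by apply: (Heta x) => //; lra.
  have yS : y <= sup S by apply: Sub; split.
  lra.
have {step Heta} [_ [n [l [r [lr lrG tlr ft]]]]] : P t.
  by apply: (Heta x) => //; lra.
have : \sum_(i < n) `|f (r i) - f (l i)| < e.
  apply: Hdelta => //; first by move=> i; have := lr i; lra.
  rewrite -lte_fin; apply: le_lt_trans mG.
  apply: sum_itv_length_le => //; first exact: open_measurable.
  by move=> i; have := lr i; lra.
have : \sum_(i < n) (f (r i) - f (l i)) <= \sum_(i < n) `|f (r i) - f (l i)|.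
  by apply: ler_sum => i _; exact: ler_norm.
have : e * (t - s + 1) = e0 by rewrite /e divfK//; apply/lt0r_neq0; lra.
lra.
Qed.

(** * Calculus of absolutely continuous functions *)

Section ac_calculus.
Context {R : realType}.
Implicit Types (a b : R) (f g : R -> R).

(** Filter monotonicity for the Lebesgue measure, stated on [R] so that later
    goals unify with it. *)
Lemma aeS2 (P Q S : R -> Prop) : (forall t, P t -> Q t -> S t) ->
  {ae (@lebesgue_measure R), forall t, P t} ->
  {ae (@lebesgue_measure R), forall t, Q t} ->
  {ae (@lebesgue_measure R), forall t, S t}.
Proof.
move=> PQS HP HQ.
have F : Filter (nbhs (almost_everywhere (@lebesgue_measure R))).
  exact: ae_filter_ringOfSetsType.
by apply: filterS2 HP HQ; exact: PQS.
Qed.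

Lemma aeS (P Q : R -> Prop) : (forall t, P t -> Q t) ->
  {ae (@lebesgue_measure R), forall t, P t} ->
  {ae (@lebesgue_measure R), forall t, Q t}.
Proof. by move=> PQ HP; apply: (aeS2 _ HP HP) => t /PQ. Qed.

Lemma Linf_norm_ae a b f (M : R) : (Linf_norm a b f <= M%:E)%E ->
  {ae (@lebesgue_measure R), forall t, t \in `]a, b[ -> `|f t| <= M}.
Proof.
rewrite /Linf_norm unlock.
have -> : (0 < @lebesgue_measure R [set: R])%E.
  by rewrite -set_itvNyy lebesgue_measure_itv/= ltry.
move=> /ess_supP; apply: filterS => t /= + tab.
by rewrite /patch mem_set//= lee_fin.
Qed.

Lemma Linf_ae a b f : Linf a b f -> exists2 M : R, 0 <= M &
  {ae (@lebesgue_measure R), forall t, t \in `]a, b[ -> `|f t| <= M}.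
Proof.
move=> [_]; rewrite -ge0_fin_numE ?Lnorm_ge0// => fM.
exists (fine (Linf_norm a b f)); first by rewrite fine_ge0// Lnorm_ge0.
by apply: Linf_norm_ae; rewrite fineK.
Qed.

Lemma abs_continuous_dist a b f : abs_continuous a b f ->
  forall eps : R, 0 < eps -> exists2 delta : R, 0 < delta &
    forall s t, s \in `[a, b] -> t \in `[a, b] -> `|t - s| < delta ->
      `|f t - f s| < eps.
Proof.
move=> acf eps eps0; have [delta delta0 H] := acf eps eps0.
exists delta => //.
have st : forall s t, s <= t -> s \in `[a, b] -> t \in `[a, b] ->
    `|t - s| < delta -> `|f t - f s| < eps.
  move=> s t st; rewrite !in_itv/= => /andP[as_ sb] /andP[at_ tb] ts.
  have := H 1%N (fun=> s) (fun=> t); rewrite !big_ord1; apply.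
  - by [].
  - by move=> i j _ _ _; rewrite !ord1.
  - by rewrite -(ger0_norm (x := t - s)) ?subr_ge0.
move=> s t sab tab ts; have [|/ltW] := leP s t; first by move=> ?; apply: st.
by move=> ?; rewrite distrC; apply: st => //; rewrite distrC.
Qed.

Lemma abs_continuous_within a b f : abs_continuous a b f ->
  {within `[a, b], continuous f}.
Proof.
move=> /abs_continuous_dist acf; apply/subspace_continuousP => x xab.
apply/cvgrPdist_lt => e e0.
have [delta delta0 H] := acf e e0.
rewrite near_withinE; apply/nbhs_ballP; exists delta => // y xy yab.
by apply: H => //; rewrite -?ball_normE.
Qed.

Lemma abs_continuous_bounded a b f : a <= b -> abs_continuous a b f ->
  exists2 M : R, 0 <= M & forall t, t \in `[a, b] -> `|f t| <= M.
Proof.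
move=> ab acf; have cf := abs_continuous_within acf.
have [c _ fc] := EVT_max ab cf; have [d _ fd] := EVT_min ab cf.
exists (`|f c| + `|f d|) => [|t tab]; first by rewrite addr_ge0.
have := fc t tab; have := fd t tab.
have := ler_norm (f c); have := ler_norm (- f d); rewrite normrN.
have := normr_ge0 (f c); have := normr_ge0 (f d).
by rewrite ler_norml; lra.
Qed.

Lemma abs_continuousD a b f g : abs_continuous a b f ->
  abs_continuous a b g -> abs_continuous a b (fun t => f t + g t).
Proof.
move=> acf acg eps eps0; have e2 : 0 < eps / 2 by lra.
have [d1 d10 H1] := acf _ e2; have [d2 d20 H2] := acg _ e2.
exists (Num.min d1 d2); first by rewrite lt_min d10.
move=> n l r lr tlr; rewrite lt_min => /andP[s1 s2].
have := H1 n l r lr tlr s1; have := H2 n l r lr tlr s2.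
suff : \sum_(i < n) `|f (r i) + g (r i) - (f (l i) + g (l i))| <=
   \sum_(i < n) `|f (r i) - f (l i)| + \sum_(i < n) `|g (r i) - g (l i)| by lra.
rewrite -big_split/=; apply: ler_sum => i _.
by rewrite opprD addrACA ler_normD.
Qed.

(** On a segment both factors are bounded, and
    [f g - f' g' = (f - f') g + (g - g') f']. *)
Lemma abs_continuousM a b f g : a <= b -> abs_continuous a b f ->
  abs_continuous a b g -> abs_continuous a b (fun t => f t * g t).
Proof.
move=> ab acf acg eps eps0.
have [M M0 fM] := abs_continuous_bounded ab acf.
have [K K0 gK] := abs_continuous_bounded ab acg.
have e1 : 0 < eps / (2 * (K + 1)) by rewrite divr_gt0//; lra.
have e2 : 0 < eps / (2 * (M + 1)) by rewrite divr_gt0//; lra.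
have [d1 d10 H1] := acf _ e1; have [d2 d20 H2] := acg _ e2.
exists (Num.min d1 d2); first by rewrite lt_min d10.
move=> n l r lr tlr; rewrite lt_min => /andP[s1 s2].
have := H1 n l r lr tlr s1; have := H2 n l r lr tlr s2.
rewrite !ltr_pdivlMr; [|lra..] => L2 L1.
suff : \sum_(i < n) `|f (r i) * g (r i) - (f (l i) * g (l i))| <=
   (\sum_(i < n) `|f (r i) - f (l i)|) * (K + 1)
   + (\sum_(i < n) `|g (r i) - g (l i)|) * (M + 1) by lra.
rewrite !mulr_suml -big_split/=; apply: ler_sum => i _.
have -> : f (r i) * g (r i) - f (l i) * g (l i) =
   (f (r i) - f (l i)) * g (r i) + (g (r i) - g (l i)) * f (l i) by ring.
have [al [lri rb]] := lr i.
rewrite (le_trans (ler_normD _ _))// !normrM lerD// ler_wpM2l//.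
  by rewrite (le_trans (gK _ _)) ?lerDl// in_itv/=; lra.
by rewrite (le_trans (fM _ _)) ?lerDl// in_itv/=; lra.
Qed.

(** A lower bound on [|f|] makes inversion Lipschitz on the values of [f]. *)
Lemma abs_continuousV a b f (m : R) : 0 < m ->
  (forall t, t \in `[a, b] -> m <= `|f t|) -> abs_continuous a b f ->
  abs_continuous a b (fun t => (f t)^-1).
Proof.
move=> m0 fm acf eps eps0.
have e1 : 0 < eps * m ^+ 2 by rewrite mulr_gt0// exprn_gt0.
have [d1 d10 H1] := acf _ e1.
exists d1 => // n l r lr tlr s1.
have := H1 n l r lr tlr s1.
rewrite -ltr_pdivrMr ?exprn_gt0//; apply: le_lt_trans.
rewrite mulr_suml; apply: ler_sum => i _.
have [al [lri rb]] := lr i.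
have fr : m <= `|f (r i)| by apply: fm; rewrite in_itv/=; lra.
have fl : m <= `|f (l i)| by apply: fm; rewrite in_itv/=; lra.
have fr0 : f (r i) != 0 by rewrite -normr_gt0; lra.
have fl0 : f (l i) != 0 by rewrite -normr_gt0; lra.
have -> : (f (r i))^-1 - (f (l i))^-1 =
    (f (l i) - f (r i)) / (f (l i) * f (r i)) by field; rewrite fr0 fl0.
rewrite normrM distrC ler_wpM2l// normfV lef_pV2 ?posrE ?normrM.
- by rewrite expr2 ler_pM// ltW.
- by rewrite mulr_gt0// normr_gt0.
- by rewrite exprn_gt0.
Qed.

Lemma abs_continuous_lipschitz a b f (k : R) :
  (forall s t, a <= s -> s <= t -> t <= b -> `|f t - f s| <= k * (t - s)) ->
  abs_continuous a b f.
Proof.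
move=> fk eps eps0.
have k1 : 0 < `|k| + 1 by have := normr_ge0 k; lra.
exists (eps / (`|k| + 1)); first by rewrite divr_gt0.
move=> n l r lr _; rewrite ltr_pdivlMr// mulr_suml; apply: le_lt_trans.
apply: ler_sum => i _; have [al [lri rb]] := lr i.
rewrite (le_trans (fk _ _ al lri rb))// mulrC ler_wpM2l ?subr_ge0//.
by have := ler_norm k; lra.
Qed.

Lemma eq_ac_derivative a b f g f' g' : f =1 f' ->
  (forall t, t \in `]a, b[ -> g t = g' t) ->
  ac_derivative a b f g -> ac_derivative a b f' g'.
Proof.
move=> /funext <- gg' [acf df]; split => //.
by move: df; apply: aeS => t dt tab; rewrite -gg'//; exact: dt.
Qed.

Lemma ac_derivativeD a b f df g dg : ac_derivative a b f df ->
  ac_derivative a b g dg ->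
  ac_derivative a b (fun t => f t + g t) (fun t => df t + dg t).
Proof.
move=> [acf Hf] [acg Hg]; split; first exact: abs_continuousD.
move: Hf Hg; apply: aeS2 => t Hf Hg tab.
by apply: is_deriveD; [exact: Hf|exact: Hg].
Qed.

Lemma ac_derivativeM a b f df g dg : a <= b -> ac_derivative a b f df ->
  ac_derivative a b g dg ->
  ac_derivative a b (fun t => f t * g t) (fun t => df t * g t + f t * dg t).
Proof.
move=> ab [acf Hf] [acg Hg]; split; first exact: abs_continuousM.
move: Hf Hg; apply: aeS2 => t Hf Hg tab.
have ? := Hf tab; have ? := Hg tab.
apply: is_derive_eq; rewrite /GRing.scale/=; ring.
Qed.

Lemma ac_derivativeV a b f df (m : R) : 0 < m ->
  (forall t, t \in `[a, b] -> m <= `|f t|) -> ac_derivative a b f df ->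
  ac_derivative a b (fun t => (f t)^-1) (fun t => - df t * (f t)^-1 ^+ 2).
Proof.
move=> m0 fm [acf Hf]; split; first exact: (abs_continuousV m0).
move: Hf; apply: aeS => t Hf tab; have [df_ dE] := Hf tab.
have ft0 : f t != 0.
  rewrite -normr_gt0 (lt_le_trans m0)// fm//.
  by move: tab; rewrite !in_itv/=; lra.
split; first exact: derivableV.
by rewrite deriveV// dE /GRing.scale/= exprVn !mulNr mulrC.
Qed.

Lemma ac_derivative_smooth a b f df : (forall t : R, is_derive t 1 f (df t)) ->
  continuous df -> a <= b -> ac_derivative a b f df.
Proof.
move=> Hf cdf ab; split; last by apply: aeW => t _.
have cn : {within `[a, b], continuous (fun t => `|df t|)}.
  apply: continuous_subspaceT => t; apply: cvg_norm; exact: cdf.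
have [c _ Hc] := EVT_max ab cn.
apply: (@abs_continuous_lipschitz _ _ _ `|df c|) => s t as_ st tb.
have [|x xst ->] := @MVT_segment R f df s t st (fun x _ => Hf x).
  by apply: derivable_within_continuous => x _; have [] := Hf x.
rewrite normrM (ger0_norm (x := t - s)) ?subr_ge0// ler_wpM2r ?subr_ge0//.
by apply: Hc; move: xst; rewrite !in_itv/=; lra.
Qed.

Lemma ac_derivative_cst a b (c : R) : a <= b ->
  ac_derivative a b (fun=> c) (fun=> 0).
Proof.
by apply: ac_derivative_smooth => t; exact: cvg_cst.
Qed.

Lemma ac_derivativeZ a b f df (c : R) : a <= b -> ac_derivative a b f df ->
  ac_derivative a b (fun t => c * f t) (fun t => c * df t).
Proof.
move=> ab Hf; have := ac_derivativeM ab (ac_derivative_cst c ab) Hf.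
by apply: eq_ac_derivative => // t _; rewrite mul0r add0r.
Qed.

Lemma ac_derivative_expR a b (k : R) : a <= b ->
  ac_derivative a b (fun t => expR (k * t)) (fun t => k * expR (k * t)).
Proof.
apply: ac_derivative_smooth => t.
  apply: is_derive_eq.
  by rewrite /GRing.scale/= mulr1 mulrC.
apply: cvgMr; apply: continuous_comp; last exact: continuous_expR.
exact: mulrl_continuous.
Qed.

Lemma ac_derivative_sub_itv a b c d f df : a <= c -> d <= b ->
  ac_derivative a b f df -> ac_derivative c d f df.
Proof.
move=> ac db [acf Hf]; split.
  move=> eps eps0; have [delta delta0 H] := acf eps eps0; exists delta => //.
  by move=> n l r lr; apply: H => i; have := lr i; lra.
move: Hf; apply: aeS => t Hf; rewrite in_itv/= => tcd.
by apply: Hf; rewrite in_itv/=; lra.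
Qed.

(** Gronwall's inequality: [expR (- k * t) * f t] is nonincreasing. The sign of
    [f] and of [k] is free, so [- f] gives the reverse inequality. *)
Lemma ac_gronwall a b f df (k : R) : a <= b -> ac_derivative a b f df ->
  {ae (@lebesgue_measure R), forall t, t \in `]a, b[ -> df t <= k * f t} ->
  forall s t, a <= s -> s <= t -> t <= b -> f t <= f s * expR (k * (t - s)).
Proof.
move=> ab Hf Hk s t as_ st tb.
have Hw := ac_derivativeM ab (ac_derivative_expR (- k) ab) Hf.
have H : expR (- k * t) * f t <= expR (- k * s) * f s.
  apply: (ac_nonincreasing Hw) => //.
  move: Hk; apply: aeS => z Hk zab.
  rewrite [leLHS](_ : _ = expR (- k * z) * (df z - k * f z)); last by ring.
  by rewrite mulr_ge0_le0 ?expR_ge0// subr_le0 Hk.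
have := ler_wpM2r (expR_ge0 (k * t)) H.
rewrite mulrAC -expRD mulNr addNr expR0 mul1r => /le_trans; apply.
by rewrite mulrAC -expRD mulrC mulrBr mulNr addrC.
Qed.

(** Both [f t - k * t] and [- f t - k * t] are nonincreasing. *)
Lemma ac_derivative_lipschitz a b f df (k : R) : a <= b ->
  ac_derivative a b f df ->
  {ae (@lebesgue_measure R), forall t, t \in `]a, b[ -> `|df t| <= k} ->
  forall s t, a <= s -> s <= t -> t <= b -> `|f t - f s| <= k * (t - s).
Proof.
move=> ab Hf Hk s t as_ st tb.
have Hlin : ac_derivative a b (fun t => - k * t) (fun=> - k).
  apply: ac_derivative_smooth => // z; last exact: cvg_cst.
  by apply: is_derive_eq; rewrite /GRing.scale/= mulr1.
have : f t + - k * t <= f s + - k * s.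
  apply: (ac_nonincreasing (ac_derivativeD Hf Hlin)) => //.
  by move: Hk; apply: aeS => z Hk /Hk; rewrite ler_norml; lra.
have : -1 * f t + - k * t <= -1 * f s + - k * s.
  apply: (ac_nonincreasing (ac_derivativeD (ac_derivativeZ (-1) ab Hf) Hlin)) => //.
  by move: Hk; apply: aeS => z Hk /Hk; rewrite ler_norml; lra.
by rewrite ler_norml; lra.
Qed.

End ac_calculus.

(** * Lower bounds for integrals *)

Section integral_bound.
Context {R : realType}.

(** The fundamental theorem of calculus for the minorant [q] on [`[a, c]]; the
    rest of the interval only adds to the integral. *)
Lemma Rintegral_ge_primitive (a b c : R) (f Q q : R -> R) :
  a < c -> c <= b -> {within `[a, b], continuous f} ->
  (forall t, 0 <= f t) -> (forall t : R, is_derive t 1 Q (q t)) -> continuous q ->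
  (forall t, t \in `[a, c] -> q t <= f t) ->
  Q c - Q a <= \int[@lebesgue_measure R]_(t in `[a, b]) f t.
Proof.
move=> ac cb cf f0 HQ cq qf.
have If : lebesgue_measure.-integrable `[a, b] (EFin \o f).
  by apply: continuous_compact_integrable => //; exact: segment_compact.
have cfc : {within `[a, c], continuous f}.
  apply: continuous_subspaceW cf => t /=; rewrite !in_itv/=; lra.
have Ifc : lebesgue_measure.-integrable `[a, c] (EFin \o f).
  by apply: continuous_compact_integrable => //; exact: segment_compact.
have Iq : lebesgue_measure.-integrable `[a, c] (EFin \o q).
  apply: continuous_compact_integrable; first exact: segment_compact.
  exact: continuous_subspaceT.
have -> : Q c - Q a = \int[@lebesgue_measure R]_(t in `[a, c]) q t.
  rewrite /Rintegral (continuous_FTC2 (F := Q))//.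
  - exact: continuous_subspaceT.
  - have cQ : continuous Q.
      by move=> t; apply/differentiable_continuous/derivable1_diffP; case: (HQ t).
    split.
    + by move=> t _; case: (HQ t).
    + by apply: cvg_at_right_filter; exact: cQ.
    + by apply: cvg_at_left_filter; exact: cQ.
  - by move=> t _; rewrite derive1E; case: (HQ t).
apply: (@le_trans _ _ (\int[@lebesgue_measure R]_(t in `[a, c]) f t)).
  by apply: le_Rintegral.
rewrite /Rintegral fine_le//.
- exact: integrable_fin_num.
- exact: integrable_fin_num.
apply: ge0_subset_integral => //.
- exact: measurable_int If.
- by move=> t _; rewrite lee_fin.
- by move=> t /=; rewrite !in_itv/=; lra.
Qed.

Lemma affine_sqr_primitive (a u v k : R) (t : R) :
  is_derive t 1 (fun t => 2^-1 * (u ^+ 2 * (t - a) - u * v * (t - a) ^+ 2 +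
      v ^+ 2 / 3 * (t - a) ^+ 3) - k * (t - a))
    (2^-1 * (u - v * (t - a)) ^+ 2 - k).
Proof.
apply: is_derive_eq.
by rewrite /GRing.scale/=; field.
Qed.

End integral_bound.

(** * The adjoint state *)

Section entries.
Context {R : realType}.

Lemma ord2_cases (i : 'I_2) : i = 0 \/ i = 1.
Proof. by case: i => -[|[|//]] p; [left|right]; apply: val_inj. Qed.

Lemma sum_ord2 (V : nmodType) (F : 'I_2 -> V) : \sum_(i < 2) F i = F 0 + F 1.
Proof. by rewrite big_ord_recl big_ord1; congr (_ + F _); apply: val_inj. Qed.

Lemma det2E (u v : 'cV[R]_2) : det2 u v = u 0 0 * v 1 0 - u 1 0 * v 0 0.
Proof.
have E0 i : (row_mx u v : 'M[R]_2) i 0 = u i 0.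
  by rewrite -(row_mxEl u v i 0); congr (_ i _); exact: val_inj.
have E1 i : (row_mx u v : 'M[R]_2) i 1 = v i 0.
  by rewrite -(row_mxEr u v i 0); congr (_ i _); exact: val_inj.
have L0 : lift 0 0 = 1 :> 'I_2 by exact: val_inj.
have L1 : lift 1 0 = 0 :> 'I_2 by exact: val_inj.
rewrite /det2; move: (row_mx u v : 'M[R]_2) E0 E1 => W E0 E1.
rewrite (expand_det_col _ 0) sum_ord2 /cofactor !det_mx11.
rewrite !mxE ?L0 ?L1 !E0 !E1 /=; ring.
Qed.

Lemma norm_entry_le (m n : nat) (A : 'M[R]_(m, n)) i j : `|A i j| <= `|A|.
Proof.
rewrite [leRHS]/Num.Def.normr/= mx_normrE.
exact: (le_bigmax _ (fun ij => `|A ij.1 ij.2|) (i, j)).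
Qed.

Lemma ac_derivative_entry (m n : nat) (a b : R) (F G : R -> 'M[R]_(m, n)) i j :
  ac_derivative a b F G ->
  ac_derivative a b (fun t => F t i j) (fun t => G t i j).
Proof.
move=> [acF HF]; split.
  move=> eps eps0; have [delta delta0 H] := acF eps eps0.
  exists delta => // k l r lr tlr sd; apply: le_lt_trans (H k l r lr tlr sd).
  apply: ler_sum => h _; apply: le_trans (norm_entry_le _ i j).
  by rewrite !mxE.
move: HF; apply: aeS => t HF tab; have [dF dE] := HF tab; split.
  by move/derivable_mxP : dF.
by rewrite -dE derive_mx// mxE.
Qed.

End entries.

(** The rows of [Phi b t] solve the adjoint equation. The regularity of [Phi] is
    known in its first argument only, so the adjoint solution is built from
    [Y t := Phi t a]: its determinant [d] satisfies [d' = tr A * d], hence does not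
    vanish, and [(p, q) := v^T Y(b) Y^-1] is given by Cramer's rule. For every [s]
    the product [(p, q) * Phi t s] has zero derivative in [t]; comparing [t = b]
    with [t = s] identifies [(p s, q s)] with [v^T Phi b s]. *)
Lemma adjoint_state (R : realType) (a b M : R) (A : R -> 'M[R]_2)
    (Phi : R -> R -> 'M[R]_2) (v : 'cV[R]_2) :
  a <= b -> (forall t i j, t \in `[a, b] -> `|A t i j| <= M) ->
  (forall s, s \in `[a, b] -> Phi s s = 1%:M /\
     ac_derivative a b (fun t => Phi t s) (fun t => A t *m Phi t s)) ->
  exists p q : R -> R, [/\
    ac_derivative a b p (fun t => - (A t 0 0 * p t + A t 1 0 * q t)),
    ac_derivative a b q (fun t => - (A t 0 1 * p t + A t 1 1 * q t)) &
    forall t (w : 'cV[R]_2), t \in `[a, b] ->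
      (v^T *m Phi b t *m w) 0 0 = p t * w 0 0 + q t * w 1 0].
Proof.
move=> ab AM HPhi.
have aab : a \in `[a, b] by rewrite in_itv/= lexx.
have bab : b \in `[a, b] by rewrite in_itv/= lexx andbT.
have Hy s i j : s \in `[a, b] -> ac_derivative a b (fun t => Phi t s i j)
    (fun t => A t i 0 * Phi t s 0 j + A t i 1 * Phi t s 1 j).
  move=> sab; have [_ /ac_derivative_entry-/(_ i j)] := HPhi _ sab.
  by apply: eq_ac_derivative => // t _; rewrite mxE sum_ord2.
pose y t i j := Phi t a i j.
have Hya i j : ac_derivative a b (fun t => y t i j)
    (fun t => A t i 0 * y t 0 j + A t i 1 * y t 1 j) by exact: Hy.
have Phi1 s i j : s \in `[a, b] -> Phi s s i j = (i == j)%:R.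
  by move=> sab; rewrite (HPhi _ sab).1 mxE.
pose d t := y t 0 0 * y t 1 1 + -1 * (y t 0 1 * y t 1 0).
have Hd : ac_derivative a b d (fun t => (A t 0 0 + A t 1 1) * d t).
  have := ac_derivativeD (ac_derivativeM ab (Hya 0 0) (Hya 1 1))
    (ac_derivativeZ (-1) ab (ac_derivativeM ab (Hya 0 1) (Hya 1 0))).
  by apply: eq_ac_derivative => // t _; rewrite /d; ring.
have d1 : d a = 1 by rewrite /d /y !Phi1//=; ring.
(* A lower bound for [|d|]: [d^2] decays at rate at most [4 * M]. *)
pose m := expR (- (4 * M) * (b - a)).
have M0 : 0 <= M by apply: le_trans (AM a 0 0 aab); exact: normr_ge0.
have dm t : t \in `[a, b] -> m <= `|d t|.
  rewrite in_itv/= => /andP[at_ tb].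
  have H : -1 * (d t * d t) <= -1 * (d a * d a) * expR (- (4 * M) * (t - a)).
    apply: (ac_gronwall ab (ac_derivativeZ (-1) ab (ac_derivativeM ab Hd Hd))) => //.
    apply: aeW => z zab.
    have zab' : z \in `[a, b] by move: zab; rewrite !in_itv/=; lra.
    have := AM z 0 0 zab'; have := AM z 1 1 zab'; rewrite !ler_norml => A1 A0.
    have := sqr_ge0 (d z); rewrite expr2; nra.
  have m1 : m <= 1.
    by rewrite -expR0 ler_expR mulNr oppr_le0 mulr_ge0 ?subr_ge0// mulr_ge0.
  have mt : m <= expR (- (4 * M) * (t - a)).
    by rewrite ler_expR ler_wnM2l ?lerD2r// oppr_le0 mulr_ge0.
  have m0 : 0 < m by exact: expR_gt0.
  rewrite d1 in H.
  have md : m ^+ 2 <= d t ^+ 2 by nra.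
  by rewrite -(ger0_norm (ltW m0)) -!sqrtr_sqr ler_wsqrtr.
have dn0 t : t \in `[a, b] -> d t != 0.
  by move=> /dm; rewrite -normr_gt0; apply: lt_le_trans; exact: expR_gt0.
(* [(q0, q1)] is the row [v^T Y(b)]. *)
pose q0 := v 0 0 * y b 0 0 + v 1 0 * y b 1 0.
pose q1 := v 0 0 * y b 0 1 + v 1 0 * y b 1 1.
pose p t := (q0 * y t 1 1 + - q1 * y t 1 0) * (d t)^-1.
pose q t := (q1 * y t 0 0 + - q0 * y t 0 1) * (d t)^-1.
have Hdi := ac_derivativeV (expR_gt0 _) dm Hd.
have Hp : ac_derivative a b p (fun t => - (A t 0 0 * p t + A t 1 0 * q t)).
  have := ac_derivativeM ab (ac_derivativeD (ac_derivativeZ q0 ab (Hya 1 1))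
    (ac_derivativeZ (- q1) ab (Hya 1 0))) Hdi.
  apply: eq_ac_derivative => // t tab; rewrite /p /q.
  have : d t != 0 by apply: dn0; move: tab; rewrite !in_itv/=; lra.
  by move=> ?; field.
have Hq : ac_derivative a b q (fun t => - (A t 0 1 * p t + A t 1 1 * q t)).
  have := ac_derivativeM ab (ac_derivativeD (ac_derivativeZ q1 ab (Hya 0 0))
    (ac_derivativeZ (- q0) ab (Hya 0 1))) Hdi.
  apply: eq_ac_derivative => // t tab; rewrite /p /q.
  have : d t != 0 by apply: dn0; move: tab; rewrite !in_itv/=; lra.
  by move=> ?; field.
have pb : p b = v 0 0.
  have db := dn0 _ bab.
  by rewrite /p /q0 /q1; rewrite /d in db *; field.
have qb : q b = v 1 0.
  have db := dn0 _ bab.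
  by rewrite /q /q0 /q1; rewrite /d in db *; field.
have Hz s j : s \in `[a, b] ->
    p b * Phi b s 0 j + q b * Phi b s 1 j = p s * Phi s s 0 j + q s * Phi s s 1 j.
  move=> sab; have := sab; rewrite in_itv/= => /andP[as_ sb].
  apply/eqP; rewrite -subr_eq0 -normr_le0 -(mul0r (b - s)).
  apply: (ac_derivative_lipschitz ab (ac_derivativeD
    (ac_derivativeM ab Hp (Hy s 0 j sab)) (ac_derivativeM ab Hq (Hy s 1 j sab)))) => //.
  apply: aeW => t _; rewrite [X in `|X|](_ : _ = 0) ?normr0//; ring.
exists p, q; split => // t w tab.
have := Hz t 0 tab; have := Hz t 1 tab; rewrite !Phi1//= pb qb.
rewrite !mxE sum_ord2 !mxE !sum_ord2 !mxE => -> ->.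
by ring.
Qed.

Lemma ac_derivative_continuous (R : realType) (a b : R) (f df : R -> R) :
  ac_derivative a b f df -> {within `[a, b], continuous f}.
Proof. by move=> [acf _]; exact: abs_continuous_within. Qed.

(** Gronwall in both directions: the squared norm of an adjoint solution changes
    at rate at most [4 * M]. *)
Lemma adjoint_growth (R : realType) (a b M : R) (A : R -> 'M[R]_2) (p q : R -> R) :
  a <= b -> (forall t i j, t \in `[a, b] -> `|A t i j| <= M) ->
  ac_derivative a b p (fun t => - (A t 0 0 * p t + A t 1 0 * q t)) ->
  ac_derivative a b q (fun t => - (A t 0 1 * p t + A t 1 1 * q t)) ->
  forall s t, a <= s -> s <= t -> t <= b ->
    p t ^+ 2 + q t ^+ 2 <= (p s ^+ 2 + q s ^+ 2) * expR (4 * M * (b - a)) /\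
    p s ^+ 2 + q s ^+ 2 <= (p t ^+ 2 + q t ^+ 2) * expR (4 * M * (b - a)).
Proof.
move=> ab AM Hp Hq s t as_ st tb.
have M0 : 0 <= M.
  by apply: le_trans (AM a 0 0 _); rewrite ?normr_ge0// in_itv/= lexx.
have Hn := ac_derivativeD (ac_derivativeM ab Hp Hp) (ac_derivativeM ab Hq Hq).
have key z : z \in `]a, b[ ->
    `|p z * (A z 0 0 * p z + A z 1 0 * q z) + q z * (A z 0 1 * p z + A z 1 1 * q z)|
    <= 2 * M * (p z * p z + q z * q z).
  move=> zab; have zab' : z \in `[a, b] by move: zab; rewrite !in_itv/=; lra.
  have := AM z 0 0 zab'; have := AM z 1 1 zab'.
  have := AM z 0 1 zab'; have := AM z 1 0 zab'.
  move: (A z 0 0) (A z 0 1) (A z 1 0) (A z 1 1) (p z) (q z) => c1 c2 c3 c4 u w.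
  rewrite !ler_norml => C3 C2 C4 C1.
  have u2 : 0 <= u * u by rewrite -expr2 sqr_ge0.
  have w2 : 0 <= w * w by rewrite -expr2 sqr_ge0.
  have B1 : -(M * (u * u)) <= c1 * (u * u) <= M * (u * u).
    by rewrite -mulNr !ler_wpM2r//; lra.
  have B4 : -(M * (w * w)) <= c4 * (w * w) <= M * (w * w).
    by rewrite -mulNr !ler_wpM2r//; lra.
  have uw : `|u * w| * 2 <= u * u + w * w.
    rewrite normrM; have := sqr_ge0 (`|u| - `|w|); rewrite sqrrB !real_normK ?num_real//.
    by rewrite !expr2; lra.
  have B2 : `|(c2 + c3) * (u * w)| <= 2 * M * `|u * w|.
    by rewrite normrM ler_wpM2r// ler_norml; lra.
  have B3 : 2 * M * `|u * w| <= M * (u * u + w * w).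
    by rewrite mulrAC mulrC ler_wpM2l// mulrC.
  move: B2; rewrite ler_norml.
  have -> : u * (c1 * u + c3 * w) + w * (c2 * u + c4 * w) =
    c1 * (u * u) + c4 * (w * w) + (c2 + c3) * (u * w) by ring.
  lra.
have Ebnd (f g : R) : 0 <= g -> f <= g * expR (4 * M * (t - s)) ->
    f <= g * expR (4 * M * (b - a)).
  move=> g0 /le_trans; apply; rewrite ler_wpM2l// ler_expR ler_wpM2l ?mulr_ge0//; lra.
have n0 z : 0 <= p z ^+ 2 + q z ^+ 2 by rewrite addr_ge0 ?sqr_ge0.
split; apply: Ebnd => //.
  rewrite !expr2; apply: (ac_gronwall ab Hn) => //.
  by apply: aeW => z /key; rewrite ler_norml; lra.
have : -1 * (p t * p t + q t * q t) <=
    -1 * (p s * p s + q s * q s) * expR (- (4 * M) * (t - s)).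
  apply: (ac_gronwall ab (ac_derivativeZ (-1) ab Hn)) => //.
  by apply: aeW => z /key; rewrite ler_norml; lra.
move=> H.
have := ler_wpM2r (expR_ge0 (4 * M * (t - s))) H.
have E1 : expR (- (4 * M) * (t - s)) * expR (4 * M * (t - s)) = 1.
  by rewrite -expRD mulNr addNr expR0.
by rewrite -[X in _ <= X]mulrA E1 !expr2; lra.
Qed.

Lemma lipschitzM (R : realType) (f g : R -> R) (s t F G kf kg : R) :
  `|f t| <= F -> `|g s| <= G -> `|f t - f s| <= kf -> `|g t - g s| <= kg ->
  `|f t * g t - f s * g s| <= F * kg + kf * G.
Proof.
move=> fF gG Hf Hg.
have -> : f t * g t - f s * g s = f t * (g t - g s) + (f t - f s) * g s by ring.
by rewrite (le_trans (ler_normD _ _))// !normrM lerD// ler_pM.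
Qed.

(** * Observability from the determinant condition *)

(** If [phi' = - psi], then near [a] the function [phi] is the affine function
    [phi a - psi a * (t - a)] up to the error [k * h ^ 2]. The square of an affine
    function [u - v * s] has integral at least a constant times
    [h * (u ^ 2 + h ^ 2 * v ^ 2)] over [0 <= s <= h], since the quadratic form
    [u ^ 2 - u * w + w ^ 2 / 3] is positive definite; for small [h] this beats the
    error, which is of order [h ^ 5]. *)
Lemma affine_observability (R : realType) (a b h : R) (phi psi : R -> R) (k m : R) :
  a < b -> 0 < h -> h <= 1 -> a + h <= b ->
  ac_derivative a b phi (fun t => - psi t) ->
  (forall t, t \in `[a, a + h] -> `|psi t - psi a| <= k * (t - a)) ->
  m <= phi a ^+ 2 + psi a ^+ 2 -> 0 <= m ->
  64 * (k ^+ 2 * h ^+ 2) <= m -> 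
  h ^+ 3 * m / 64 <= \int[@lebesgue_measure R]_(t in `[a, b]) (phi t ^+ 2).
Proof.
move=> ab h0 h1 ahb Hphi Hpsi mge m0 kh.
have k0 : 0 <= k.
  have := Hpsi (a + h); rewrite in_itv/= lexx andbT.
  move=> /(_ ltac:(lra)) H; have := le_trans (normr_ge0 _) H.
  by rewrite addrAC subrr add0r pmulr_lge0.
set u := phi a; set v := psi a.
have ah : a <= a + h by lra.
have err t : t \in `[a, a + h] -> `|phi t - (u - v * (t - a))| <= k * h * h.
  rewrite in_itv/= => /andP[at_ th].
  have Hlin : ac_derivative a (a + h) (fun t => v * t) (fun=> v).
    apply: ac_derivative_smooth => // z; last exact: cvg_cst.
    by apply: is_derive_eq; rewrite /GRing.scale/= mulr1.
  have Hs := ac_derivativeD (ac_derivative_sub_itv (lexx a) ahb Hphi) Hlin.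
  have := ac_derivative_lipschitz ah Hs (k := k * h).
  move=> /(_ _ a t (lexx a) at_ th) H.
  have -> : phi t - (u - v * (t - a)) = phi t + v * t - (phi a + v * a).
    by rewrite /u; ring.
  apply: le_trans (H _) _.
    apply: aeW => z; rewrite in_itv/= => /andP[az zh].
    have -> : - psi z + v = - (psi z - v) by ring.
    rewrite normrN.
    apply: le_trans (Hpsi z _) _; first by rewrite in_itv/= !ltW.
    by rewrite ler_wpM2l//; lra.
  by rewrite ler_wpM2l ?mulr_ge0 ?(ltW h0)//; lra.
pose eps := (k * h * h) ^+ 2.
have HQ := affine_sqr_primitive a u v eps.
have key : h ^+ 3 * m / 64 <=
   2^-1 * (u ^+ 2 * h - u * v * h ^+ 2 + v ^+ 2 / 3 * h ^+ 3) - eps * h.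
  have e1 : eps * h <= h ^+ 3 * m / 64.
    have -> : eps * h = h ^+ 3 * (64 * (k ^+ 2 * h ^+ 2)) / 64 by rewrite /eps; field.
    by rewrite ler_wpM2r// ler_wpM2l// exprn_ge0// ltW.
  (* [1/16] is below the least eigenvalue of the form [u^2 - u w + w^2 / 3]. *)
  have e2 : (u ^+ 2 + (v * h) ^+ 2) / 16 <= u ^+ 2 - u * (v * h) + (v * h) ^+ 2 / 3.
    move: (v * h) => w; rewrite -subr_ge0.
    have -> : u ^+ 2 - u * w + w ^+ 2 / 3 - (u ^+ 2 + w ^+ 2) / 16 =
      15 / 16 * (u - 8 / 15 * w) ^+ 2 + w ^+ 2 / 240 by field.
    by have := sqr_ge0 (u - 8 / 15 * w); have := sqr_ge0 w; lra.
  have h2 : h ^+ 2 <= 1 by rewrite expr_le1// ltW.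
  have e3 : h ^+ 2 * m <= u ^+ 2 + (v * h) ^+ 2.
    apply: le_trans (ler_wpM2l (sqr_ge0 h) mge) _.
    by rewrite exprMn mulrDr lerD ?ler_piMl ?sqr_ge0// mulrC.
  have e4 : h * (h ^+ 2 * m / 16) <= h * (u ^+ 2 - u * (v * h) + (v * h) ^+ 2 / 3).
    by rewrite ler_wpM2l ?(ltW h0)//; lra.
  rewrite -subr_ge0 in e4; rewrite -subr_ge0 in e1; rewrite -subr_ge0.
  have -> : 2^-1 * (u ^+ 2 * h - u * v * h ^+ 2 + v ^+ 2 / 3 * h ^+ 3) - eps * h -
    h ^+ 3 * m / 64 = (h ^+ 3 * m / 64 - eps * h) + 2^-1 *
    (h * (u ^+ 2 - u * (v * h) + (v * h) ^+ 2 / 3) - h * (h ^+ 2 * m / 16)) by field.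
  by rewrite addr_ge0// mulr_ge0.
apply: (le_trans key).
pose Q t := 2^-1 * (u ^+ 2 * (t - a) - u * v * (t - a) ^+ 2 +
      v ^+ 2 / 3 * (t - a) ^+ 3) - eps * (t - a).
have -> : 2^-1 * (u ^+ 2 * h - u * v * h ^+ 2 + v ^+ 2 / 3 * h ^+ 3) - eps * h
   = Q (a + h) - Q a by rewrite /Q; field.
apply: (Rintegral_ge_primitive (q := fun t => 2^-1 * (u - v * (t - a)) ^+ 2 - eps)) => //.
- by lra.
- exact: (ac_derivative_continuous (ac_derivativeM (ltW ab) Hphi Hphi)).
- by move=> t; exact: sqr_ge0.
- have Hd (t : R) : is_derive t 1 (fun t => 2^-1 * (u - v * (t - a)) ^+ 2 - eps)
     (- v * (u - v * (t - a))).
    by apply: is_derive_eq; rewrite /GRing.scale/=; field.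
  by move=> t; apply/differentiable_continuous/derivable1_diffP; case: (Hd t).
- move=> t /err; set z := u - v * (t - a) => H.
  have : (phi t - z) ^+ 2 <= eps.
    by rewrite -real_normK ?num_real// /eps ler_sqr ?nnegrE ?mulr_ge0 ?(ltW h0).
  by have := sqr_ge0 (2 * phi t - z); nra.
Qed.

(** A quantitative Kalman rank test at the initial time. With [(p, q)] the adjoint
    state, [phi = (p, q) * B] is the observed signal and
    [phi' = - psi] with [psi = (p, q) * (A B - dB)]. The determinant condition at
    [a] says that [(phi a, psi a)] determines [(p a, q a)], whose norm is comparable to
    that of [v]; and [psi] is Lipschitz because [A], [B], [dB] and the adjoint state
    are. Only the values at [a] and the variation from them matter, because the
    observation on a short interval after [a] is enough. *)
Lemma kalman_observability (R : realType) (a b M L beta : R) :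
  a < b -> 0 < M -> 0 <= L -> 0 < beta ->
  exists2 alpha : R, 0 < alpha &
  forall (A : R -> 'M[R]_2) (B dB : R -> 'cV[R]_2) (Phi : R -> R -> 'M[R]_2),
  (forall t i j, t \in `[a, b] -> `|A t i j| <= M) ->
  (forall t i, t \in `[a, b] -> `|B t i 0| <= M) ->
  (forall t i, t \in `[a, b] -> `|dB t i 0| <= M) ->
  (forall t i j, t \in `[a, b] -> `|A t i j - A a i j| <= L * (t - a)) ->
  (forall t i, t \in `[a, b] -> `|dB t i 0 - dB a i 0| <= L * (t - a)) ->
  ac_derivative a b B dB ->
  beta <= `|det2 (B a) (A a *m B a - dB a)| ->
  (forall s, s \in `[a, b] -> Phi s s = 1%:M /\
     ac_derivative a b (fun t => Phi t s) (fun t => A t *m Phi t s)) ->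
  forall v : 'cV[R]_2,
    {within `[a, b], continuous (fun t => (v^T *m Phi b t *m B t) 0 0)} /\
    alpha * (v 0 0 ^+ 2 + v 1 0 ^+ 2) <=
      \int[@lebesgue_measure R]_(t in `[a, b]) ((v^T *m Phi b t *m B t) 0 0) ^+ 2.
Proof.
move=> ab M0 L0 beta0.
pose E := expR (4 * M * (b - a)).
have E0 : 0 < E by exact: expR_gt0.
(* For [c := A B - dB]: [C] bounds its entries, [Lc] is a Lipschitz constant of
   them, and [K] times the bound of the adjoint state is one of [psi]. *)
pose C := 2 * M ^+ 2 + M.
pose Lc := 2 * (M * M + L * M) + L.
pose K := 2 * (Lc + 2 * M * C).
have C0 : 0 <= C by rewrite /C; have := sqr_ge0 M; lra.
have Lc0 : 0 <= Lc.
  by rewrite /Lc addr_ge0// mulr_ge0// addr_ge0// mulr_ge0// ltW.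
have K0 : 0 <= K by rewrite /K mulr_ge0// addr_ge0// mulr_ge0// mulr_ge0// ltW.
have CM0 : 0 < 4 * (C ^+ 2 + M ^+ 2).
  by apply: mulr_gt0 => //; apply: ltr_wpDl; [exact: sqr_ge0|exact: exprn_gt0].
(* [phi a ^ 2 + psi a ^ 2] is at least [m * |v|^2]. *)
pose m := beta ^+ 2 / (4 * (C ^+ 2 + M ^+ 2)) / E.
have m0 : 0 < m by do 2![apply: divr_gt0 => //]; exact: exprn_gt0.
have EK0 : 0 < 64 * (E * K ^+ 2) + 1.
  by rewrite ltr_wpDl// mulr_ge0// mulr_ge0 ?sqr_ge0// ltW.
(* Since [h <= 1], bounding [h] by the last quotient also bounds [h ^ 2]. *)
pose h := Num.min 1 (Num.min (b - a) (m / (64 * (E * K ^+ 2) + 1))).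
have h0 : 0 < h by rewrite !lt_min ltr01 subr_gt0 ab divr_gt0.
have h1 : h <= 1 by rewrite ge_min lexx.
have hba : a + h <= b.
  by rewrite addrC -lerBrDr !ge_min lexx orbT.
have hm : 64 * (E * K ^+ 2 * h ^+ 2) <= m.
  have : h * (64 * (E * K ^+ 2) + 1) <= m.
    by rewrite -ler_pdivlMr// !ge_min lexx !orbT.
  apply: le_trans; rewrite expr2 mulrDr mulr1.
  have : 64 * (E * K ^+ 2 * (h * h)) <= 64 * (E * K ^+ 2 * h).
    rewrite ler_wpM2l// ler_wpM2l// ?ler_piMl ?(ltW h0)//.
    by rewrite mulr_ge0 ?sqr_ge0// ltW.
  lra.
exists (h ^+ 3 * m / 64); first by do 2![apply: mulr_gt0 => //]; exact: exprn_gt0.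
move=> A B dB Phi AM BM dBM AL dBL HB Hdet HPhi v.
have aab : a \in `[a, b] by rewrite in_itv/= lexx ltW.
have [p [q [Hp Hq pqE]]] := adjoint_state v (ltW ab) AM HPhi.
have grow := adjoint_growth (ltW ab) AM Hp Hq.
have pb : p b = v 0 0 /\ q b = v 1 0.
  have bab : b \in `[a, b] by rewrite in_itv/= lexx ltW.
  have := pqE b (delta_mx 0 0) bab; have := pqE b (delta_mx 1 0) bab.
  rewrite (HPhi _ bab).1 mulmx1 !mxE !sum_ord2 !mxE/=.
  by split; lra.
set V := v 0 0 ^+ 2 + v 1 0 ^+ 2.
have V0 : 0 <= V by rewrite addr_ge0 ?sqr_ge0.
pose P := Num.sqrt (E * V).
have P2 : P ^+ 2 = E * V by rewrite sqr_sqrtr// mulr_ge0// ltW.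
have P0 : 0 <= P by exact: sqrtr_ge0.
have pqP t : t \in `[a, b] -> `|p t| <= P /\ `|q t| <= P.
  rewrite in_itv/= => /andP[at_ tb].
  have [_] := grow t b at_ tb (lexx b); rewrite pb.1 pb.2 -/V -/E mulrC -P2 => H.
  have := sqr_ge0 (p t); have := sqr_ge0 (q t) => q2 p2.
  by split; rewrite -[leRHS]ger0_norm// -ler_sqr ?nnegrE// !real_normK ?num_real//; lra.
have Va : V <= E * (p a ^+ 2 + q a ^+ 2).
  by have [+ _] := grow a b (lexx a) (ltW ab) (lexx b); rewrite pb.1 pb.2 mulrC.
pose c i t := A t i 0 * B t 0 0 + A t i 1 * B t 1 0 - dB t i 0.
pose phi t := p t * B t 0 0 + q t * B t 1 0.
pose psi t := p t * c 0 t + q t * c 1 t.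
have HBi i := ac_derivative_entry i 0 HB.
have Hphi : ac_derivative a b phi (fun t => - psi t).
  have := ac_derivativeD (ac_derivativeM (ltW ab) Hp (HBi 0))
    (ac_derivativeM (ltW ab) Hq (HBi 1)).
  by apply: eq_ac_derivative => // t _; rewrite /psi /c; ring.
have phiE t : t \in `[a, b] -> (v^T *m Phi b t *m B t) 0 0 = phi t.
  by move=> tab; rewrite pqE.
have cC i t : t \in `[a, b] -> `|c i t| <= C.
  move=> tab; rewrite /c /C (le_trans (ler_normB _ _))// lerD ?dBM//.
  rewrite (le_trans (ler_normD _ _))// mulr2n mulrDl mul1r !normrM expr2.
  by rewrite lerD// ler_pM ?AM ?BM.
have BL i t : t \in `[a, b] -> `|B t i 0 - B a i 0| <= M * (t - a).
  move=> tab; have := tab; rewrite in_itv/= => /andP[at_ tb].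
  apply: (ac_derivative_lipschitz (ltW ab) (HBi i)) => //.
  by apply: aeW => z zab; apply: dBM; move: zab; rewrite !in_itv/=; lra.
have ABL i j t : t \in `[a, b] ->
    `|A t i j * B t j 0 - A a i j * B a j 0| <= (M * M + L * M) * (t - a).
  move=> tab; rewrite mulrDl -mulrA [L * M * _]mulrAC.
  apply: (@lipschitzM _ (fun t => A t i j) (fun t => B t j 0)).
  - exact: AM.
  - exact: BM.
  - exact: AL.
  - exact: BL.
have cL i t : t \in `[a, b] -> `|c i t - c i a| <= Lc * (t - a).
  move=> tab; have := ABL i 0 t tab; have := ABL i 1 t tab; have := dBL t i tab.
  by rewrite /c /Lc !ler_norml; lra.
have pL (f g1 g2 : R -> R) t :
    (forall t, t \in `[a, b] -> `|g1 t| <= M /\ `|g2 t| <= M) ->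
    ac_derivative a b f (fun t => - (g1 t * p t + g2 t * q t)) ->
    t \in `[a, b] -> `|f t - f a| <= 2 * M * P * (t - a).
  move=> gM Hf; rewrite in_itv/= => /andP[at_ tb].
  apply: (ac_derivative_lipschitz (ltW ab) Hf) => //.
  apply: aeW => z zab.
  have zab' : z \in `[a, b] by move: zab; rewrite !in_itv/=; lra.
  have [g1M g2M] := gM _ zab'; have [pP qP] := pqP _ zab'.
  rewrite normrN (le_trans (ler_normD _ _))// !normrM -mulrA mulr2n mulrDl mul1r.
  by rewrite lerD// ler_pM.
have psiL t : t \in `[a, b] -> `|psi t - psi a| <= P * K * (t - a).
  move=> tab; have [pP qP] := pqP _ tab.
  have H0 := lipschitzM pP (cC 0 _ aab)
    (pL p (fun t => A t 0 0) (fun t => A t 1 0) t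
      (fun z zab => conj (AM z 0 0 zab) (AM z 1 0 zab)) Hp tab) (cL 0 t tab).
  have H1 := lipschitzM qP (cC 1 _ aab)
    (pL q (fun t => A t 0 1) (fun t => A t 1 1) t
      (fun z zab => conj (AM z 0 1 zab) (AM z 1 1 zab)) Hq tab) (cL 1 t tab).
  have -> : psi t - psi a = (p t * c 0 t - p a * c 0 a) + (q t * c 1 t - q a * c 1 a).
    by rewrite /psi; ring.
  apply: le_trans (ler_normD _ _) _; apply: le_trans (lerD H0 H1) _.
  by rewrite le_eqVlt; apply/orP; left; apply/eqP; rewrite /K; ring.
(* Cramer's rule, [D] times the adjoint state being a combination of [phi] and
   [psi] with coefficients among the entries of [c] and [B]. *)
have mle : m * V <= phi a ^+ 2 + psi a ^+ 2.
  have D2 : beta ^+ 2 * (p a ^+ 2 + q a ^+ 2) <=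
      4 * (C ^+ 2 + M ^+ 2) * (phi a ^+ 2 + psi a ^+ 2).
    move: Hdet; rewrite det2E !mxE !sum_ord2 -/(c 0 a) -/(c 1 a).
    set D := _ - _ => Hdet.
    have bD : beta ^+ 2 <= D ^+ 2.
      by rewrite -[leRHS]real_normK ?num_real// ler_sqr ?nnegrE// ltW.
    have sq x (X : R) : `|x| <= X -> x ^+ 2 <= X ^+ 2.
      move=> H; rewrite -[leLHS]real_normK ?num_real// ler_sqr ?nnegrE//.
      by apply: le_trans H; exact: normr_ge0.
    have c0 := sq _ _ (cC 0 a aab); have c1 := sq _ _ (cC 1 a aab).
    have b0 := sq _ _ (BM a 0 aab); have b1 := sq _ _ (BM a 1 aab).
    have DE : D ^+ 2 * (p a ^+ 2 + q a ^+ 2) =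
      (phi a * c 1 a - psi a * B a 1 0) ^+ 2 + (psi a * B a 0 0 - phi a * c 0 a) ^+ 2.
      by rewrite /D /phi /psi; ring.
    have sq2 x y (X Y : R) : x ^+ 2 <= X -> y ^+ 2 <= Y ->
        (phi a * x - psi a * y) ^+ 2 <= 2 * (phi a ^+ 2 * X + psi a ^+ 2 * Y).
      move=> xX yY.
      have := ler_wpM2l (sqr_ge0 (phi a)) xX; have := ler_wpM2l (sqr_ge0 (psi a)) yY.
      by have := sqr_ge0 (phi a * x + psi a * y); rewrite sqrrD sqrrB !exprMn; lra.
    apply: (@le_trans _ _ (D ^+ 2 * (p a ^+ 2 + q a ^+ 2))).
      by rewrite ler_wpM2r// addr_ge0 ?sqr_ge0.
    rewrite DE -[in X in _ + X]sqrrN opprB.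
    have := lerD (sq2 _ _ _ _ c1 b1) (sq2 _ _ _ _ c0 b0).
    have := mulr_ge0 (sqr_ge0 (phi a)) (sqr_ge0 M).
    have := mulr_ge0 (sqr_ge0 (psi a)) (sqr_ge0 C).
    have -> : 4 * (C ^+ 2 + M ^+ 2) * (phi a ^+ 2 + psi a ^+ 2) =
      4 * (phi a ^+ 2 * C ^+ 2) + 4 * (psi a ^+ 2 * C ^+ 2) +
      4 * (phi a ^+ 2 * M ^+ 2) + 4 * (psi a ^+ 2 * M ^+ 2) by ring.
    lra.
  rewrite /m mulrAC ler_pdivrMr// mulrAC ler_pdivrMr//.
  apply: le_trans (ler_wpM2l (sqr_ge0 beta) Va) _.
  rewrite mulrCA.
  apply: le_trans (ler_wpM2l (ltW E0) D2) _.
  by rewrite le_eqVlt; apply/orP; left; apply/eqP; ring.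
have cphi := ac_derivative_continuous Hphi.
have eqphi : {in `[a, b], phi =1 (fun t => (v^T *m Phi b t *m B t) 0 0)}.
  by move=> t tab; rewrite phiE.
split.
  by apply: subspace_eq_continuous cphi => t; rewrite inE/= => tab; exact: eqphi.
have -> : \int[@lebesgue_measure R]_(t in `[a, b]) ((v^T *m Phi b t *m B t) 0 0) ^+ 2 =
    \int[@lebesgue_measure R]_(t in `[a, b]) phi t ^+ 2.
  by apply: eq_Rintegral => t; rewrite inE/= => tab; rewrite eqphi.
have -> : h ^+ 3 * m / 64 * V = h ^+ 3 * (m * V) / 64 by ring.
apply: (affine_observability ab h0 h1 hba Hphi (k := P * K) _ mle).
- by move=> t tah; apply: psiL; move: tah; rewrite !in_itv/=; lra.
- by rewrite mulr_ge0// ltW.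
- rewrite exprMn P2.
  have := ler_wpM2r V0 hm.
  by apply: le_trans; rewrite le_eqVlt; apply/orP; left; apply/eqP; ring.
Qed.

(** * Regularity of the field along trajectories *)

Section field.
Context {R : realType}.

Lemma is_derive_line (V : normedModType R) (g : V -> R) (x v : V) (s : R) :
  derivable g (s *: v + x) v ->
  is_derive s 1 (fun r : R => g (r *: v + x)) ('D_v g (s *: v + x)).
Proof.
move=> dg.
have E : (fun k : R => k^-1 *: (((fun r : R => g (r *: v + x)) \o shift s) (k *: (1 : R))
      - g (s *: v + x))) =
    (fun k : R => k^-1 *: ((g \o shift (s *: v + x)) (k *: v) - g (s *: v + x))).
  apply/funext => k /=; rewrite /shift/= addrA -scalerDl.
  by congr (_ *: (g (_ *: _ + _) - _)); rewrite /GRing.scale/= mulr1.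
by split; rewrite /derivable /derive E.
Qed.

Lemma line_lipschitz (V : normedModType R) (g : V -> R) (v : V) (C : R) :
  (forall x, derivable g x v) -> (forall x, `|'D_v g x| <= C) ->
  forall x (r : R), `|g (r *: v + x) - g x| <= C * `|r|.
Proof.
move=> dg gC x r.
pose k (s : R) := g (s *: v + x).
have Hk (s : R) : is_derive s 1 k ('D_v g (s *: v + x)) by exact: is_derive_line.
have ck (i : interval R) : {within [set` i], continuous k}.
  by apply: derivable_within_continuous => z _; case: (Hk z).
have k0 : k 0 = g x by rewrite /k scale0r add0r.
rewrite -/(k r) -k0.
have [r0|r0] := leP 0 r.
  have [z _ ->] := MVT_segment r0 (fun z _ => Hk z) (ck _).
  by rewrite subr0 normrM ler_wpM2r.
have [z _ E] := MVT_segment (ltW r0) (fun z _ => Hk z) (ck _).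
by rewrite distrC E sub0r normrM normrN ler_wpM2r.
Qed.

(** Bounded partial derivatives suffice: move along one axis at a time. *)
Lemma plane_lipschitz (g : 'cV[R]_2 -> R) (C : R) :
  (forall x j, derivable g x (delta_mx j 0)) ->
  (forall x j, `|'D_(delta_mx j 0) g x| <= C) ->
  forall y z, `|g y - g z| <= C * (`|y 0 0 - z 0 0| + `|y 1 0 - z 1 0|).
Proof.
move=> dg gC y z.
pose w := (y 0 0 - z 0 0) *: (delta_mx 0 0 : 'cV[R]_2) + z.
have -> : y = (y 1 0 - z 1 0) *: delta_mx 1 0 + w.
  apply/colP => i; rewrite !mxE.
  have [->|->] := ord2_cases i.
  - by rewrite /= mulr0 add0r mulr1 subrK.
  - by rewrite /= mulr0 add0r mulr1 subrK.
have H1 := line_lipschitz (dg^~ 1) (gC^~ 1) w (y 1 0 - z 1 0).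
have H0 := line_lipschitz (dg^~ 0) (gC^~ 0) z (y 0 0 - z 0 0).
rewrite -/w in H0.
set y' := _ + w in H1 *.
have -> : y' 0 0 = y 0 0 by rewrite !mxE /=; ring.
have -> : y' 1 0 = y 1 0 by rewrite !mxE /=; ring.
have -> : g y' - g z = (g y' - g w) + (g w - g z) by ring.
by rewrite (le_trans (ler_normD _ _))// mulrDr addrC lerD.
Qed.

Lemma entry_le_enorm (n : nat) (v : 'cV[R]_n) i : `|v i 0| <= enorm v.
Proof.
rewrite -sqrtr_sqr ler_wsqrtr// (bigD1 i)//= lerDl.
by apply: sumr_ge0 => j _; exact: sqr_ge0.
Qed.

Lemma enorm_delta (j : 'I_2) : enorm (delta_mx j 0 : 'cV[R]_2) = 1.
Proof.
rewrite /enorm (bigD1 j)//= big1 => [|i ij].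
  by rewrite mxE !eqxx expr1n addr0 sqrtr1.
by rewrite mxE (negbTE ij) expr0n.
Qed.

Lemma enorm2 (v : 'cV[R]_2) : enorm v ^+ 2 = v 0 0 ^+ 2 + v 1 0 ^+ 2.
Proof.
rewrite /enorm sqr_sqrtr; first by rewrite sum_ord2.
by apply: sumr_ge0 => j _; exact: sqr_ge0.
Qed.

Lemma jac_entry_le (f : 'cV[R]_2 -> 'cV[R]_2) (x : 'cV[R]_2) (k : R) :
  (forall v, enorm (jac f x *m v) <= k * enorm v) ->
  forall i j, `|jac f x i j| <= k.
Proof.
move=> H i j; have := le_trans (entry_le_enorm _ i) (H (delta_mx j 0)).
by rewrite enorm_delta mulr1 -colE mxE.
Qed.

Lemma C1_entry_derivable (f : 'cV[R]_2 -> 'cV[R]_2) x v i : C1 f ->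
  derivable (fun y => f y i 0) x v /\
  'D_v (fun y => f y i 0) x = ('D_v f x) i 0.
Proof.
move=> [df _]; have dv : derivable f x v by exact: diff_derivable.
split; first by move/derivable_mxP : dv.
by rewrite derive_mx// mxE.
Qed.

Lemma field_lipschitz (f : 'cV[R]_2 -> 'cV[R]_2) (k : R) : C1 f ->
  (forall x v, enorm (jac f x *m v) <= k * enorm v) ->
  forall y z i, `|f y i 0 - f z i 0| <= k * (`|y 0 0 - z 0 0| + `|y 1 0 - z 1 0|).
Proof.
move=> Cf H y z i; apply: (plane_lipschitz (g := fun y => f y i 0)) => x j.
  by have [] := C1_entry_derivable x (delta_mx j 0) i Cf.
have [_ ->] := C1_entry_derivable x (delta_mx j 0) i Cf.
by have := jac_entry_le (H x) i j; rewrite mxE.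
Qed.

Lemma jac_lipschitz (f : 'cV[R]_2 -> 'cV[R]_2) (k : R) : C2 f ->
  (forall x v w, enorm ('D_w (fun y => 'D_v f y) x) <= k * enorm v * enorm w) ->
  forall y z i j,
    `|jac f y i j - jac f z i j| <= k * (`|y 0 0 - z 0 0| + `|y 1 0 - z 1 0|).
Proof.
move=> [_ Cf] H y z i j; rewrite !mxE.
apply: (plane_lipschitz (g := fun y => ('D_(delta_mx j 0) f y) i 0)) => x l.
  by have [] := C1_entry_derivable x (delta_mx l 0) i (Cf (delta_mx j 0)).
have [_ ->] := C1_entry_derivable x (delta_mx l 0) i (Cf (delta_mx j 0)).
have := le_trans (entry_le_enorm _ i) (H x (delta_mx j 0) (delta_mx l 0)).
by rewrite !enorm_delta !mulr1.
Qed.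

(** Linear growth of the right-hand side: Gronwall for [x ^ 2 + y ^ 2 + 1]. *)
Lemma linear_growth_bounded (a b F k : R) (x y f g : R -> R) :
  a <= b -> 0 <= F -> 0 <= k -> ac_derivative a b x f -> ac_derivative a b y g ->
  {ae (@lebesgue_measure R), forall t, t \in `]a, b[ ->
    `|f t| <= F + k * (`|x t| + `|y t|)} ->
  {ae (@lebesgue_measure R), forall t, t \in `]a, b[ ->
    `|g t| <= F + k * (`|x t| + `|y t|)} ->
  forall t, t \in `[a, b] ->
    `|x t| + `|y t| <=
      (x a ^+ 2 + y a ^+ 2 + 1) * expR ((2 * F + 4 * k) * (b - a)).
Proof.
move=> ab F0 k0 Hx Hy fF gF t; rewrite in_itv/= => /andP[at_ tb].
have Hn := ac_derivativeD (ac_derivativeD (ac_derivativeM ab Hx Hx)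
  (ac_derivativeM ab Hy Hy)) (ac_derivative_cst 1 ab).
have H : x t * x t + y t * y t + 1 <= (x a * x a + y a * y a + 1) *
    expR ((2 * F + 4 * k) * (t - a)).
  apply: (ac_gronwall ab Hn) => //.
  move: fF gF; apply: aeS2 => z fF gF zab; move: (fF zab) (gF zab).
  move: (f z) (g z) (x z) (y z) => u v p q => uF vF.
  have H1 : u * p <= (F + k * (`|p| + `|q|)) * `|p|.
    by rewrite (le_trans (ler_norm _))// normrM ler_wpM2r.
  have H2 : v * q <= (F + k * (`|p| + `|q|)) * `|q|.
    by rewrite (le_trans (ler_norm _))// normrM ler_wpM2r.
  have p2 : `|p| * `|p| = p * p by rewrite -!expr2 real_normK ?num_real.
  have q2 : `|q| * `|q| = q * q by rewrite -!expr2 real_normK ?num_real.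
  rewrite -p2 -q2.
  have pF := mulr_ge0 F0 (sqr_ge0 (`|p| - 1)).
  have qF := mulr_ge0 F0 (sqr_ge0 (`|q| - 1)).
  have pq := mulr_ge0 k0 (sqr_ge0 (`|p| - `|q|)).
  have p0 := mulr_ge0 F0 (sqr_ge0 `|p|).
  have q0 := mulr_ge0 F0 (sqr_ge0 `|q|).
  lra.
have H1 : (x a * x a + y a * y a + 1) * expR ((2 * F + 4 * k) * (t - a)) <=
    (x a ^+ 2 + y a ^+ 2 + 1) * expR ((2 * F + 4 * k) * (b - a)).
  rewrite -!expr2 ler_wpM2l ?addr_ge0 ?sqr_ge0// ler_expR ler_wpM2l ?lerD2r//.
  by rewrite addr_ge0// mulr_ge0.
have x2 : `|x t| * `|x t| = x t * x t by rewrite -!expr2 real_normK ?num_real.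
have y2 : `|y t| * `|y t| = y t * y t by rewrite -!expr2 real_normK ?num_real.
apply: le_trans (le_trans H H1).
have := sqr_ge0 (`|x t| - 1); have := sqr_ge0 (`|y t| - 1) => X Y.
by have := sqr_ge0 (x t); have := sqr_ge0 (y t); lra.
Qed.

End field.

(** * The quadratic form of the Gramian *)

(** [v^T G v] is the integral of the squared observed signal. Continuity of the signals
    makes the entries of the Gramian integrals of integrable functions. *)
Lemma gramian_form (R : realType) (a b : R) (B : R -> 'cV[R]_2)
    (Phi : R -> R -> 'M[R]_2) :
  (forall v : 'cV[R]_2,
    {within `[a, b], continuous (fun t => (v^T *m Phi b t *m B t) 0 0)}) ->
  (gramian a b B Phi)^T = gramian a b B Phi /\
  forall v : 'cV[R]_2, (v^T *m gramian a b B Phi *m v) 0 0 =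
    \int[@lebesgue_measure R]_(t in `[a, b]) ((v^T *m Phi b t *m B t) 0 0) ^+ 2.
Proof.
move=> cv; pose g i t := (Phi b t *m B t) i 0.
have gE (v : 'cV[R]_2) t : (v^T *m Phi b t *m B t) 0 0 = v 0 0 * g 0 t + v 1 0 * g 1 t.
  by rewrite -mulmxA mxE sum_ord2 [v^T 0 0]mxE [v^T 0 1]mxE.
have GE i j : gramian a b B Phi i j =
    \int[@lebesgue_measure R]_(t in `[a, b]) (g i t * g j t).
  rewrite mxE; apply: eq_Rintegral => t _.
  by rewrite -mulmxA -trmx_mul mxE big_ord1 [X in _ * X]mxE.
have cg i : {within `[a, b], continuous (g i)}.
  have -> : g i = (fun t => (((delta_mx i 0 : 'cV[R]_2)^T *m Phi b t *m B t) 0 0)).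
    by apply/funext => t; rewrite trmx_delta -mulmxA -rowE mxE.
  exact: cv.
have Icont (f : R -> R) : {within `[a, b], continuous f} ->
    lebesgue_measure.-integrable `[a, b] (EFin \o f).
  by apply: continuous_compact_integrable; exact: segment_compact.
have cZ (c : R) i j : {within `[a, b], continuous (fun t => c * (g i t * g j t))}.
  by move=> t; apply: cvgM; [exact: cvg_cst|apply: cvgM; exact: cg].
have Ig i j : lebesgue_measure.-integrable `[a, b] (EFin \o (fun t => g i t * g j t)).
  by apply: Icont => t; apply: cvgM; exact: cg.
split.
  apply/matrixP => i j; rewrite mxE !GE.
  by apply: eq_Rintegral => t _; rewrite mulrC.
move=> v.
have -> : \int[@lebesgue_measure R]_(t in `[a, b]) ((v^T *m Phi b t *m B t) 0 0) ^+ 2 =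
   \int[@lebesgue_measure R]_(t in `[a, b]) (v 0 0 ^+ 2 * (g 0 t * g 0 t) +
     (2 * v 0 0 * v 1 0 * (g 0 t * g 1 t) + v 1 0 ^+ 2 * (g 1 t * g 1 t))).
  by apply: eq_Rintegral => t _; rewrite gE; ring.
rewrite !RintegralD//; try exact: Icont; last first.
  by apply: Icont => t; apply: cvgD; exact: cZ.
rewrite !RintegralZl// -!GE.
have sym : gramian a b B Phi 1 0 = gramian a b B Phi 0 1.
  by rewrite !GE; apply: eq_Rintegral => t _; rewrite mulrC.
move: (gramian a b B Phi) sym => G sym.
by rewrite mxE sum_ord2 !mxE !sum_ord2 !mxE sym; ring.
Qed.

(** * Uniform bounds and the theorem *)

Lemma ord2_bound (R : realType) (P : 'I_2 -> R -> Prop) :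
  (forall i M M', M <= M' -> P i M -> P i M') ->
  (forall i, exists2 M : R, 0 <= M & P i M) ->
  exists2 M : R, 0 <= M & forall i, P i M.
Proof.
move=> Pmono PM; have [M0 M00 P0] := PM 0; have [M1 M10 P1] := PM 1.
exists (M0 + M1) => [|i]; first exact: addr_ge0.
have [->|->] := ord2_cases i.
- by apply: Pmono P0; rewrite lerDl.
- by apply: Pmono P1; rewrite lerDr.
Qed.

(** A common bound for [B], [dB] and the variation of [dB] from its initial value.
    They hold everywhere on the segment, not only almost everywhere, because [B]
    and [dB] are absolutely continuous. *)
Lemma input_bounds (R : realType) (t0 T : R) (B dB : R -> 'cV[R]_2) :
  t0 <= T -> input_assumptions t0 T B dB ->
  exists2 M : R, 0 <= M & forall i,
   [/\ forall t, t \in `[t0, T] -> `|B t i 0| <= M,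
       forall t, t \in `[t0, T] -> `|dB t i 0| <= M &
       forall t, t \in `[t0, T] -> `|dB t i 0 - dB t0 i 0| <= M * (t - t0)].
Proof.
move=> tT [HB _ _ [ddB HdB LddB]].
apply: ord2_bound => [i M M' MM' [H1 H2 H3]|i].
  split=> t tT'; [exact: le_trans (H1 t tT') MM'|exact: le_trans (H2 t tT') MM'|].
  apply: le_trans (H3 t tT') _; rewrite ler_wpM2r// subr_ge0.
  by move: tT'; rewrite in_itv => /andP[].
have [M1 M10 H1] := abs_continuous_bounded tT (ac_derivative_entry i 0 HB).1.
have HdBi := ac_derivative_entry i 0 HdB.
have [M2 M20 H2] := abs_continuous_bounded tT HdBi.1.
have [M3 M30 H3] := Linf_ae (LddB i 0).
exists (M1 + M2 + M3); first by rewrite !addr_ge0.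
split=> t tT'.
- by apply: le_trans (H1 t tT') _; lra.
- by apply: le_trans (H2 t tT') _; lra.
have /andP[t0t tT''] : (t0 <= t <= T) by move: tT'; rewrite in_itv.
apply: le_trans (ac_derivative_lipschitz tT HdBi H3 (lexx t0) t0t tT'') _.
by rewrite ler_wpM2r ?subr_ge0//; lra.
Qed.

(** The system matrix along a trajectory is Lipschitz at [t0], uniformly in the control.
    The trajectory is bounded in terms of [r] and [U] by linear growth, hence
    Lipschitz. The variation of [jac (N t) (x t)] is then split by freezing [x t]: the
    time variation at the fixed point [x t] is controlled by the bound on the time
    derivative, and the space variation at the fixed time [t0] by the second
    derivative. No derivative of [jac (N t) (x t)] is taken: the null sets where the
    time derivative fails may depend on the point. *)
Lemma jac_trajectory_lipschitz (R : realType) (t0 T : R)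
    (N : R -> 'cV[R]_2 -> 'cV[R]_2) (B : R -> 'cV[R]_2) (MB r U : R) :
  t0 <= T -> field_assumptions t0 T N -> 0 <= U -> 0 <= MB ->
  (forall t i, t \in `[t0, T] -> `|B t i 0| <= MB) ->
  exists2 L : R, 0 <= L & forall (u : R -> R) x0 x,
    enorm x0 = r -> (Linf_norm t0 T u <= U%:E)%E -> is_trajectory t0 T N B x0 u x ->
    forall t i j, t \in `[t0, T] ->
      `|jac (N t) (x t) i j - jac (N t0) (x t0) i j| <= L * (t - t0).
Proof.
move=> tT [N0 NC2 [L1 L10 HL1] [L2 L20 HL2] [L3 HL3]] U0 MB0 HB.
have [CN CN0 HCN] : exists2 M : R, 0 <= M & forall i,
    {ae (@lebesgue_measure R), forall t, t \in `]t0, T[ -> `|N t 0 i 0| <= M}.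
  apply: ord2_bound => [i M M' MM'|i].
    by apply: aeS => t H tt; exact: le_trans (H tt) MM'.
  exact: Linf_ae (N0 0 i 0).
pose F := CN + U * MB.
have F0 : 0 <= F by rewrite addr_ge0// mulr_ge0.
pose X := (r ^+ 2 + 1) * expR ((2 * F + 4 * L1) * (T - t0)).
have X0 : 0 <= X by rewrite mulr_ge0 ?expR_ge0// addr_ge0 ?sqr_ge0.
pose V := F + L1 * X.
have V0 : 0 <= V by rewrite addr_ge0// mulr_ge0.
exists (`|L3| + 2 * L2 * V); first by rewrite addr_ge0// !mulr_ge0.
move=> u x0 x xr uU [xt0 Hx] t i j tT'.
have /andP[t0t tT''] : (t0 <= t <= T) by move: tT'; rewrite in_itv.
have t0T : t0 \in `[t0, T] by rewrite in_itv/= lexx.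
have sub z : z \in `]t0, T[ -> z \in `[t0, T] by rewrite !in_itv/=; lra.
have Hxi k := ac_derivative_entry k 0 Hx.
have fF k : {ae (@lebesgue_measure R), forall z, z \in `]t0, T[ ->
    `|(N z (x z) + u z *: B z) k 0| <= F + L1 * (`|x z 0 0| + `|x z 1 0|)}.
  have := Linf_norm_ae uU; move: (HCN k); apply: aeS2 => z Nz uz zT.
  have zT' := sub _ zT.
  have := field_lipschitz (NC2 z zT').1 (fun y v => HL1 z y v zT') (x z) 0 k.
  rewrite !mxE !subr0 => HN.
  have uB : `|u z * B z k 0| <= U * MB by rewrite normrM ler_pM// ?uz ?HB.
  have := Nz zT; rewrite -[N z (x z) k 0](subrK (N z 0 k 0)) /F.
  have := ler_normD (N z (x z) k 0 - N z 0 k 0 + N z 0 k 0) (u z * B z k 0).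
  have := ler_normD (N z (x z) k 0 - N z 0 k 0) (N z 0 k 0).
  lra.
have xX z : z \in `[t0, T] -> `|x z 0 0| + `|x z 1 0| <= X.
  move=> zT; have := linear_growth_bounded tT F0 L10 (Hxi 0) (Hxi 1) (fF 0) (fF 1) zT.
  by rewrite xt0 -enorm2 xr.
have xL k : `|x t k 0 - x t0 k 0| <= V * (t - t0).
  apply: (ac_derivative_lipschitz tT (Hxi k)) => //.
  move: (fF k); apply: aeS => z Hz zT; apply: le_trans (Hz zT) _.
  by rewrite lerD2l ler_wpM2l// xX// sub.
have J2 := jac_lipschitz (NC2 t0 t0T) (fun y v w => HL2 t0 y v w t0T) (x t) (x t0) i j.
have J3 : `|jac (N t) (x t) i j - jac (N t0) (x t) i j| <= `|L3| * (t - t0).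
  have [dD Hd [_ dL3]] := HL3 (x t).
  apply: (ac_derivative_lipschitz tT (ac_derivative_entry i j Hd)) => //.
  have := Linf_norm_ae (dL3 i j); apply: aeS => z Hz zT.
  by apply: le_trans (Hz zT) _; exact: ler_norm.
have J4 : L2 * (`|x t 0 0 - x t0 0 0| + `|x t 1 0 - x t0 1 0|) <=
    L2 * (V * (t - t0) + V * (t - t0)) by rewrite ler_wpM2l// lerD.
rewrite -[X in `|X|](subrKA (jac (N t0) (x t) i j)).
apply: le_trans (ler_normD _ _) _; lra.
Qed.

Theorem propositionV1 (R : realType) (t0 T : R) (h0 : 0 <= t0) (hT : t0 < T)
    (N : R -> 'cV[R]_2 -> 'cV[R]_2) (B dB : R -> 'cV[R]_2)
    (hN : field_assumptions t0 T N) (hB : input_assumptions t0 T B dB) :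
  exists alpha : R -> R -> R -> R,
  forall beta : R, 0 < beta ->
    (forall (t : R) (x : 'cV[R]_2), t \in `[t0, T] ->
       beta <= `|det2 (B t) (jac (N t) x *m B t - dB t)|) ->
  forall (x0 : 'cV[R]_2) (U : R), 0 < U ->
    0 < alpha beta (enorm x0) U /\
    forall u : R -> R, Linf t0 T u -> (Linf_norm t0 T u <= U%:E)%E ->
    forall (x : R -> 'cV[R]_2) (Phi : R -> R -> 'M[R]_2),
      is_trajectory t0 T N B x0 u x ->
      is_transition_matrix t0 T N x Phi ->
      loewner_ge (gramian t0 T B Phi) (alpha beta (enorm x0) U)%:M.
Proof.
have tT := ltW hT.
have [M M0 HM] := input_bounds tT hB.
have [_ _ [L1 L10 HL1] _ _] := hN.
(* [alpha] is chosen pointwise: for given [beta], [r = enorm x0] and [U], the constant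
   of the rank test only sees the bounds derived from them. *)
pose P (z : R * R * R) (alpha : R) := 0 < z.1.1 -> 0 < z.2 -> 0 < alpha /\
  forall x0 : 'cV[R]_2, enorm x0 = z.1.2 ->
  forall u, (Linf_norm t0 T u <= z.2%:E)%E ->
  forall x Phi, is_trajectory t0 T N B x0 u x ->
  is_transition_matrix t0 T N x Phi ->
  z.1.1 <= `|det2 (B t0) (jac (N t0) (x t0) *m B t0 - dB t0)| ->
  loewner_ge (gramian t0 T B Phi) alpha%:M.
have /boolp.choice[alpha Halpha] z : exists alpha, P z alpha.
  case: z => -[beta r] U; rewrite /P/=.
  have [beta0|] := ltP 0 beta; last by exists 0; lra.
  have [U0|] := ltP 0 U; last by exists 0; lra.
  have [L L0 HL] := jac_trajectory_lipschitz r tT hN (ltW U0) M0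
    (fun t i => let: And3 H _ _ := HM i in H t).
  have M'0 : 0 < 1 + M + L1 by lra.
  have [alpha alpha0 Ha] := kalman_observability hT M'0 (addr_ge0 M0 L0) beta0.
  exists alpha => _ _; split => // x0 xr u uU x Phi Hx HPhi Hdet.
  have [HB _ _ _] := hB.
  have Hobs : forall v : 'cV[R]_2,
      {within `[t0, T], continuous (fun t => (v^T *m Phi T t *m B t) 0 0)} /\
      alpha * (v 0 0 ^+ 2 + v 1 0 ^+ 2) <=
      \int[@lebesgue_measure R]_(t in `[t0, T]) ((v^T *m Phi T t *m B t) 0 0) ^+ 2.
    apply: (Ha (fun t => jac (N t) (x t)) B dB Phi _ _ _ _ _ HB Hdet HPhi) =>
      t i => [j tT'|tT'|tT'|j tT'|tT'].
    - by apply: le_trans (jac_entry_le (fun v => HL1 t (x t) v tT') i j) _; lra.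
    - by have [H _ _] := HM i; apply: le_trans (H t tT') _; lra.
    - by have [_ H _] := HM i; apply: le_trans (H t tT') _; lra.
    - apply: le_trans (HL u x0 x xr uU Hx t i j tT') _.
      by move: tT'; rewrite in_itv/= => /andP[? _]; rewrite ler_wpM2r ?subr_ge0//; lra.
    - have [_ _ H] := HM i; apply: le_trans (H t tT') _.
      by move: tT'; rewrite in_itv/= => /andP[? _]; rewrite ler_wpM2r ?subr_ge0//; lra.
  have [Gsym Gform] := gramian_form (fun v => (Hobs v).1).
  split=> [|v]; first by rewrite linearB/= Gsym tr_scalar_mx.
  have := (Hobs v).2; rewrite -Gform -subr_ge0.
  rewrite mulmxBr mulmxBl mul_mx_scalar -scalemxAl.
  move: (v^T *m gramian t0 T B Phi *m v) => G.
  by rewrite !mxE sum_ord2 !mxE -!expr2.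
exists (fun beta r U => alpha (beta, r, U)) => beta beta0 Hdet x0 U U0.
have [a0 Ha] := Halpha (beta, enorm x0, U) beta0 U0.
split=> // u _ uU x Phi Hx HPhi; apply: (Ha x0 erefl u uU x Phi Hx HPhi).
by apply: Hdet; rewrite in_itv/= lexx.
Qed.
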